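(* Let $r\ge 0$ be an integer. Any simplicial complex $K$ with property $Q_r$ is $r$-connected.
   Context: Simplexes of a simplicial complex are non-empty. For a vertex $v$ of a simplicial complex $K$, the closed star $\mathrm{st}_K(v)$ is the subcomplex of $K$ consisting of all simplexes $\sigma\in K$ with $\sigma\cup\{v\}\in K$. Property $Q_r$ ($r\ge 0$ an integer): a simplicial complex $K$ has property $Q_r$ if every subcomplex $L\subseteq K$ with at most $2r+2$ vertices and at most $3^{r+1}-1$ simplexes (of all dimensions, counting vertices) is contained in the closed star $\mathrm{st}_K(v)$ of some vertex $v\in K$. A topological space $X$ is $r$-connected ($r\ge 0$) if it is non-empty and every continuous map $S^d\to X$ with $0\le d\le r$ extends to a continuous map $D^{d+1}\to X$; a simplicial complex is $r$-connected if its geometric realisation is. *)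

(* Defs.v *)
From HB Require Import structures.
From mathcomp Require Export all_boot all_order all_algebra finmap.
From mathcomp Require Export all_classical all_reals all_analysis.
Export Order.TTheory GRing.Theory Num.Theory numFieldNormedType.Exports.

Set Implicit Arguments.
Unset Strict Implicit.
Unset Printing Implicit Defensive.

Local Open Scope classical_set_scope.
Local Open Scope card_scope.
Local Open Scope ring_scope.

(* Complexes may be infinite or empty, and not every element of the ambient
   type [V] has to be a vertex. *)
Record simplicial_complex (V : choiceType) := Complex {
  simplexes : set {fset V};
  simplex_neq0 : forall s, simplexes s -> s != fset0;
  simplex_face : forall s t : {fset V},
    simplexes s -> (t `<=` s)%fset -> t != fset0 -> simplexes t }.

Definition vertices (V : choiceType) (K : simplicial_complex V) : set V :=
  [set v | simplexes K [fset v]%fset].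

Definition subcomplex (V : choiceType) (L K : simplicial_complex V) : Prop :=
  simplexes L `<=` simplexes K.

Section ClosedStar.
Context (V : choiceType) (K : simplicial_complex V) (v : V).

Let star : set {fset V} := [set s | simplexes K s /\ simplexes K (v |` s)%fset].

Lemma star_neq0 s : star s -> s != fset0.
Proof. by move=> [/simplex_neq0]. Qed.

Lemma star_face (s t : {fset V}) :
  star s -> (t `<=` s)%fset -> t != fset0 -> star t.
Proof.
move=> [Ks Kvs] ts t0; split; first exact: (simplex_face Ks).
apply: (simplex_face Kvs); first exact: fsetUS.
by apply/fset0Pn; exists v; exact: fset1U1.
Qed.

Definition closed_star : simplicial_complex V := Complex star_neq0 star_face.
End ClosedStar.

(* The empty subcomplex is one of the [L], so [property_Q r K] forces [K] to
   have a vertex. *)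
Definition property_Q (V : choiceType) (r : nat) (K : simplicial_complex V) :
    Prop :=
  forall L : simplicial_complex V, subcomplex L K ->
    vertices L #<= `I_(2 * r + 2)%N ->
    simplexes L #<= `I_(3 ^ r.+1 - 1)%N ->
    exists2 v, vertices K v & subcomplex L (closed_star K v).

(* The closed geometric simplex |s|, in barycentric coordinates. *)
Definition geometric_simplex (R : realType) (V : choiceType) (s : {fset V}) :
    set (V -> R) :=
  [set x | [/\ forall v, 0 <= x v, forall v, v \notin s -> x v = 0
             & \sum_(v <- s) x v = 1]].

Record realization (R : realType) (V : choiceType) (K : simplicial_complex V) :=
  Realization {
    bary :> V -> R ;
    baryP : exists2 s : {fset V}, simplexes K s & geometric_simplex s bary }.

Section RealizationTopology.
Context (R : realType) (V : choiceType) (K : simplicial_complex V).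

HB.instance Definition _ := gen_eqMixin (realization R K).
HB.instance Definition _ := gen_choiceMixin (realization R K).

(* The weak (coherent) topology: [A] is open iff its trace on every |s|, [s] a
   simplex of [K], is open in |s|, where |s| has the topology induced by its
   inclusion in R^s (the finite product [{ptws s -> R}]). *)
Definition coherent_open : set_system (realization R K) :=
  [set A | forall s : {fset V}, simplexes K s ->
    exists2 O : set {ptws s -> R}, open O &
      forall x : realization R K, geometric_simplex s x ->
        (A x <-> O (fun v : s => x (val v)))].

Lemma coherent_openT : coherent_open setT.
Proof. by move=> s Ks; exists setT => //; exact: openT. Qed.

Lemma coherent_openI : setI_closed coherent_open.
Proof.
move=> A B oA oB s Ks.
have [OA oOA AP] := oA s Ks; have [OB oOB BP] := oB s Ks.
exists (OA `&` OB); first exact: openI.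
move=> x sx; have := AP x sx; have := BP x sx.
by rewrite /setI /=; tauto.
Qed.

Lemma coherent_open_bigU (I : Type) (f : I -> set (realization R K)) :
  (forall i, coherent_open (f i)) -> coherent_open (\bigcup_i f i).
Proof.
move=> of_ s Ks.
have /choice [U UP] : forall i : I, exists O : set {ptws s -> R}, open O /\
    forall x : realization R K, geometric_simplex s x ->
      (f i x <-> O (fun v : s => x (val v))).
  by move=> i; have [W oW WP] := of_ i s Ks; exists W.
exists (\bigcup_i U i); first by apply: bigcup_open => i _; exact: (UP i).1.
move=> x sx; split=> -[i _ fx]; exists i => //; exact/((UP i).2 x sx).
Qed.

HB.instance Definition _ := isOpenTopological.Build (realization R K)
  coherent_openT coherent_openI coherent_open_bigU.
End RealizationTopology.

(* The norm of the library on ['rV[R]_n] is the sup norm, hence the sums of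
   squares; the topology is the usual one of R^n. *)
Definition unit_sphere (R : realType) (d : nat) : set 'rV[R]_d.+1 :=
  [set x : 'rV[R]_d.+1 | \sum_i x ord0 i ^+ 2 = 1].

Definition unit_disk (R : realType) (n : nat) : set 'rV[R]_n :=
  [set x : 'rV[R]_n | \sum_i x ord0 i ^+ 2 <= 1].

Arguments unit_sphere : clear implicits.
Arguments unit_disk : clear implicits.

(* Maps on S^d and D^(d+1) are represented by total functions on R^(d+1), whose
   values outside the sphere (resp. the disk) are irrelevant. *)
Definition r_connected (R : realType) (r : nat) (X : topologicalType) : Prop :=
  [set: X] !=set0 /\
  forall d : nat, (d <= r)%N ->
    forall f : 'rV[R]_d.+1 -> X, {within unit_sphere R d, continuous f} ->
    exists2 g : 'rV[R]_d.+1 -> X,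
      {within unit_disk R d.+1, continuous g} &
      forall x, unit_sphere R d x -> g x = f x.

Definition complex_r_connected (R : realType) (V : choiceType) (r : nat)
    (K : simplicial_complex V) : Prop :=
  r_connected R r (realization R K).

(* Main.v *)
(** Every point of |K| has superlevel sets (of its barycentric coordinates) that
    are simplexes; for a subcomplex L, the points having one in L form an open set
    N(L), and N commutes with intersections.  If L is a cone, N(L) is filled: lower
    the coordinates until the support lies in L, then slide to the apex.

    A map from a sphere to N(L) has finite support, so it lands in the union of
    the N(st_L(v)) for finitely many vertices v.  If L has the property Q with
    bounds 2q and 3^q-1, the intersection of k >= 2 distinct closed stars has it with
    q+1-k in place of q: apply the property of L to a small subcomplex M of the
    intersection together with the cones over M with apexes the k vertices, and use
    2p+k <= 2q and (k+1) 3^p <= 3^q for p = q+1-k.  By induction on q these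
    intersections are (p-1)-connected, and the union is (q-1)-connected by gluing:
    fillings over open sets A and B of X, and over the intersection A & B in lower
    dimensions, give fillings over the union, on a grid so fine that each cell of
    the boundary is mapped into A or into B. *)

Require Import Defs.
From mathcomp Require Import ring lra zify.
Set Implicit Arguments.
Unset Strict Implicit.
Unset Printing Implicit Defensive.

Local Open Scope classical_set_scope.
Local Open Scope ring_scope.
Local Open Scope card_scope.

(** * Maps on subspaces *)

Lemma within_compose (T U W : topologicalType) (D : set T) (E : set U)
    (p : T -> U) (f : U -> W) :
  {within D, continuous p} -> {within E, continuous f} ->
  (forall x, D x -> E (p x)) -> {within D, continuous (f \o p)}.
Proof.
move=> /subspace_continuousP cp /subspace_continuousP cf DE.
apply/subspace_continuousP => x Dx S /(cf _ (DE _ Dx)) /= fS.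
move: (cp _ Dx _ fS); rewrite /nbhs /= /within /= => H.
by apply: filterS H => y H Dy; exact: (H Dy (DE _ Dy)).
Qed.

Lemma eq_within (T U : topologicalType) (D : set T) (f g : T -> U) :
  (forall x, D x -> f x = g x) -> {within D, continuous f} ->
  {within D, continuous g}.
Proof.
move=> fg /subspace_continuousP cf; apply/subspace_continuousP => x Dx S.
rewrite /from_subspace -fg // => /(cf _ Dx); rewrite /nbhs /= /within /= => H.
by apply: filterS H => y H Dy; rewrite /= /from_subspace -fg //; exact: H.
Qed.

Section RowVectors.
Context (R : realType).

Lemma within_row (T : topologicalType) n (D : set T) (h : T -> 'rV[R]_n) :
  (forall i, {within D, continuous (fun x => h x ord0 i)}) ->
  {within D, continuous h}.
Proof.
move=> ch; apply/subspace_continuousP => x Dx.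
apply/cvgrPdist_lt => e e0.
have : \forall y \near within D (nbhs x), forall i, `|h x ord0 i - h y ord0 i| < e.
  apply: filter_forall => i.
  by have /subspace_continuousP/(_ x Dx)/cvgrPdist_lt/(_ e e0) := ch i.
apply: filterS => y hy; rewrite [X in X < _]/Num.norm /= mx_normrE.
apply/bigmax_ltP; split => // -[i j] _ /=.
by rewrite !mxE (ord1 i).
Qed.

Lemma within_coord_id n (D : set 'rV[R]_n) i :
  {within D, continuous (fun x : 'rV[R]_n => x ord0 i)}.
Proof. exact/continuous_subspaceT/coord_continuous. Qed.

Lemma row_norm_le n (x : 'rV[R]_n) (c : R) : 0 <= c ->
  (`|x| <= c) <-> (forall i, `|x ord0 i| <= c).
Proof.
move=> c0; rewrite [X in X <= _]/Num.norm /= mx_normrE; split.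
  by move=> /bigmax_leP[_ H] i; exact: (H (ord0, i)).
by move=> H; apply/bigmax_leP; split => // -[i j] _ /=; rewrite (ord1 i).
Qed.

Lemma le_coord_norm n (x : 'rV[R]_n) i : `|x ord0 i| <= `|x|.
Proof. exact: ((row_norm_le x (normr_ge0 x)).1 (lexx _)). Qed.

Lemma row_norm_attained n (x : 'rV[R]_n) :
  x != 0 -> exists i, `|x| = `|x ord0 i|.
Proof.
rewrite -normr_eq0 => x0.
have [[i j] /= xij] := mx_norm_neq0 x0.
by exists j; rewrite [LHS]xij (ord1 i).
Qed.

(** Balls of the sup norm replace Euclidean balls because they subdivide into boxes. In dimension 0
    the boundary is empty, since the only vector has norm 0. *)
Definition cube n : set 'rV[R]_n := [set x | `|x| <= 1].
Definition cube_boundary n : set 'rV[R]_n := [set x | `|x| = 1].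

Lemma cube_boundaryP n (x : 'rV[R]_n) :
  cube_boundary x <-> cube x /\ exists i, `|x ord0 i| = 1.
Proof.
rewrite /cube_boundary /cube /=; split.
  move=> x1; split; first by rewrite x1.
  have [|i xi] := @row_norm_attained _ x; last by exists i; rewrite -xi.
  by rewrite -normr_eq0 x1 oner_eq0.
by move=> [x1 [i xi]]; apply/le_anti; rewrite x1 -[X in X <= _]xi le_coord_norm.
Qed.

Lemma closed_cube_boundary n : closed (@cube_boundary n).
Proof.
have -> : @cube_boundary n = Num.norm @^-1` [set 1] by [].
by apply: preimage_closed => [x _|]; [exact: norm_continuous|exact: closed_eq].
Qed.

Lemma compact_cube_boundary n : compact (@cube_boundary n).
Proof.
apply: bounded_closed_compact; last exact: closed_cube_boundary.
exists 1; split; first exact: num_real.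
by move=> M M1 x /= ->; exact: ltW.
Qed.

End RowVectors.

(** * Filling cubes and boxes *)

Section WithinReal.
Context (R : realType) (T : topologicalType) (D : set T).
Implicit Types f g : T -> R.

Lemma within_cst (U : topologicalType) (c : U) : {within D, continuous (fun=> c)}.
Proof. by apply/subspace_continuousP => x _; exact: cvg_cst. Qed.

Lemma withinD f g : {within D, continuous f} -> {within D, continuous g} ->
  {within D, continuous (fun x => f x + g x)}.
Proof.
move=> /subspace_continuousP cf /subspace_continuousP cg.
by apply/subspace_continuousP => x Dx; apply: cvgD; [exact: cf|exact: cg].
Qed.

Lemma withinN f : {within D, continuous f} ->
  {within D, continuous (fun x => - f x)}.
Proof.
move=> /subspace_continuousP cf.
by apply/subspace_continuousP => x Dx; apply: cvgN; exact: cf.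
Qed.

Lemma withinB f g : {within D, continuous f} -> {within D, continuous g} ->
  {within D, continuous (fun x => f x - g x)}.
Proof. by move=> cf cg; apply: withinD => //; exact: withinN. Qed.

Lemma withinM f g : {within D, continuous f} -> {within D, continuous g} ->
  {within D, continuous (fun x => f x * g x)}.
Proof.
move=> /subspace_continuousP cf /subspace_continuousP cg.
by apply/subspace_continuousP => x Dx; apply: cvgM; [exact: cf|exact: cg].
Qed.

Lemma withinV f : (forall x, D x -> f x != 0) -> {within D, continuous f} ->
  {within D, continuous (fun x => (f x)^-1)}.
Proof.
move=> f0 /subspace_continuousP cf.
by apply/subspace_continuousP => x Dx; apply: cvgV; [exact: f0|exact: cf].
Qed.

Lemma within_max f g : {within D, continuous f} -> {within D, continuous g} ->
  {within D, continuous (fun x => Num.max (f x) (g x))}.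
Proof. by move=> cf cg x; apply: continuous_max; [exact: cf|exact: cg]. Qed.

Lemma within_min f g : {within D, continuous f} -> {within D, continuous g} ->
  {within D, continuous (fun x => Num.min (f x) (g x))}.
Proof. by move=> cf cg x; apply: continuous_min; [exact: cf|exact: cg]. Qed.

Lemma within_sum (I : Type) (s : seq I) (F : I -> T -> R) :
  (forall i, {within D, continuous (F i)}) ->
  {within D, continuous (fun x => \sum_(i <- s) F i x)}.
Proof.
move=> cF; elim: s => [|i s IHs].
  by under eq_fun do rewrite big_nil; exact: within_cst.
by under eq_fun do rewrite big_cons; exact: withinD.
Qed.

End WithinReal.

Section Fillable.
Context (R : realType) (X : topologicalType).

(* Non-emptiness is required separately: for [n = 0] the boundary is empty, but
   a map ['rV_0 -> X] has to be given. *)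
Definition fillable n (A : set X) := A !=set0 /\
  forall f : 'rV[R]_n -> X, {within @cube_boundary R n, continuous f} ->
    (forall x, cube_boundary x -> A (f x)) ->
  exists g : 'rV[R]_n -> X, [/\ {within @cube R n, continuous g},
    forall x, cube x -> A (g x) & forall x, cube_boundary x -> g x = f x].

Section Box.
Context (n : nat) (a b : 'I_n -> R).

Definition box : set 'rV[R]_n := [set x | forall i, a i <= x ord0 i <= b i].
(** This is the relative boundary: only directions of positive length contribute, so a degenerate
    box has the boundary of a cube of its true dimension. *)
Definition box_boundary : set 'rV[R]_n :=
  [set x | box x /\ exists2 i, a i < b i & x ord0 i = a i \/ x ord0 i = b i].

Let F : {set 'I_n} := [set i | a i < b i].

Let to_cube (x : 'rV[R]_n) : 'rV[R]_#|F| :=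
  \row_j (let i := enum_val j in (x ord0 i - a i) / (b i - a i) * 2 - 1).
Let of_cube (y : 'rV[R]_#|F|) : 'rV[R]_n :=
  \row_i (if [pick j : 'I_#|F| | enum_val j == i] is Some j
          then a i + (b i - a i) * ((y ord0 j + 1) / 2) else a i).

Let enum_val_lt (j : 'I_#|F|) : a (enum_val j) < b (enum_val j).
Proof. by have := enum_valP j; rewrite inE. Qed.

Let to_cubeK x : box x -> of_cube (to_cube x) = x.
Proof.
move=> bx; apply/rowP => i; rewrite !mxE; case: pickP => [j /eqP <-|noj].
  rewrite mxE /=; have := enum_val_lt j; set k := enum_val j => abk.
  by field; rewrite subr_eq0 gt_eqF.
have iF : i \notin F.
  apply/negP => iF; have := noj (enum_rank_in iF i).
  by rewrite enum_rankK_in ?eqxx.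
move: iF (bx i); rewrite inE -leNgt => ba /andP[ax xb]; apply/le_anti.
by rewrite ax (le_trans xb ba).
Qed.

Let within_to_cube D : {within D, continuous to_cube}.
Proof.
apply: within_row => j; under eq_fun do rewrite mxE.
apply: withinD; last exact: within_cst.
by do 2 (apply: withinM; last exact: within_cst); apply: withinB;
  [exact: within_coord_id|exact: within_cst].
Qed.

Let within_of_cube D : {within D, continuous of_cube}.
Proof.
apply: within_row => i; under eq_fun do rewrite mxE.
case: pickP => [j _|_]; last exact: within_cst.
apply: withinD; first exact: within_cst.
apply: withinM; first exact: within_cst.
apply: withinM; last exact: within_cst.
by apply: withinD; [exact: within_coord_id|exact: within_cst].
Qed.

Let cube_to_cube x : box x -> cube (to_cube x).
Proof.
move=> bx; apply/row_norm_le => // j; rewrite mxE /=.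
move: (bx (enum_val j)) (enum_val_lt j); set i := enum_val j => /andP[ax xb] ab.
have d0 : 0 < b i - a i by rewrite subr_gt0.
have : 0 <= (x ord0 i - a i) / (b i - a i) by rewrite divr_ge0 ?subr_ge0 // ltW.
have : (x ord0 i - a i) / (b i - a i) <= 1 by rewrite ler_pdivrMr // mul1r lerB.
by rewrite ler_norml; lra.
Qed.

Let cube_boundary_to_cube x : box_boundary x -> cube_boundary (to_cube x).
Proof.
move=> [bx [i abi xi]]; apply/cube_boundaryP; split; first exact: cube_to_cube.
have iF : i \in F by rewrite inE.
exists (enum_rank_in iF i); rewrite mxE enum_rankK_in //=.
have ba : b i - a i != 0 by rewrite subr_eq0 gt_eqF.
by case: xi => ->; rewrite ?subrr ?mul0r ?divff // ?sub0r ?normrN ?normr1 //;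
  rewrite mul1r [2 - 1](_ : _ = 1) ?normr1 //; lra.
Qed.

Hypothesis ab : forall i, a i <= b i.

Let box_of_cube y : cube y -> box (of_cube y).
Proof.
move=> /row_norm_le cy i; rewrite mxE; case: pickP => [j _|_]; last first.
  by rewrite lexx ab.
have := cy ler01 j; rewrite ler_norml => /andP[y1 y2].
have := ab i; rewrite -subr_ge0; set d := b i - a i => d0.
have -> : b i = a i + d * 1 by rewrite /d; ring.
by rewrite lerD2l lerDl mulr_ge0 //= ?ler_wpM2l //; lra.
Qed.

Let box_boundary_of_cube y : cube_boundary y -> box_boundary (of_cube y).
Proof.
move=> /cube_boundaryP[cy [j yj]]; split; first exact: box_of_cube.
exists (enum_val j); first exact: enum_val_lt.
rewrite mxE; case: pickP => [k /eqP/enum_val_inj ->|/(_ j)]; last by rewrite eqxx.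
have [y0|y0] := leP 0 (y ord0 j).
  by right; move: yj; rewrite ger0_norm // => ->; field.
by left; move: yj; rewrite ltr0_norm // => /(canRL (@opprK _)) ->; field.
Qed.

(** [to_cube] and [of_cube] identify the box with a cube whose dimension is the number of
    nondegenerate directions, and they match the boundaries; a filling of the cube therefore
    transports to the box. *)
Lemma fill_box (A : set X) (f : 'rV[R]_n -> X) :
  fillable #|[set i | a i < b i]%SET| A ->
  {within box_boundary, continuous f} -> (forall x, box_boundary x -> A (f x)) ->
  exists g : 'rV[R]_n -> X, [/\ {within box, continuous g},
    forall x, box x -> A (g x) & forall x, box_boundary x -> g x = f x].
Proof.
move=> [_ fillA] cf Af.
have [||g [cg Ag gf]] := fillA (f \o of_cube).
- exact: (@within_compose _ _ _ _ _ of_cube f (@within_of_cube _) cf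
    box_boundary_of_cube).
- by move=> x /box_boundary_of_cube /Af.
exists (g \o to_cube); split.
- exact: (@within_compose _ _ _ _ _ to_cube g (@within_to_cube _) cg cube_to_cube).
- by move=> x /cube_to_cube /Ag.
- move=> x /[dup] -[bx _] bdx /=; rewrite gf /= ?to_cubeK //.
  exact: cube_boundary_to_cube.
Qed.

End Box.
End Fillable.

(** * Gluing two open sets *)

Section Subdivision.
Context (R : realType) (X : topologicalType) (n : nat).

Lemma closed_box (a b : 'I_n -> R) : closed (box a b).
Proof.
have -> : box a b = \bigcap_i ((fun x : 'rV[R]_n => x ord0 i) @^-1` `[a i, b i]).
  rewrite /box; apply/seteqP; split => x /= H; first by move=> i _; rewrite /= in_itv /=.
  by move=> i; have := H i I; rewrite /= in_itv.
apply: closed_bigI => i _; apply: preimage_closed => [x _|].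
  exact: coord_continuous.
exact: itv_closed.
Qed.

Definition grid_cell (k : 'I_n -> nat) : set 'rV[R]_n :=
  box (fun i => (k i)%:R) (fun i => (k i).+1%:R).

Definition grid_box (a b : 'I_n -> nat) : set 'rV[R]_n :=
  box (fun i => (a i)%:R) (fun i => (b i)%:R).

Definition grid_boundary (a b : 'I_n -> nat) : set 'rV[R]_n :=
  box_boundary (fun i => (a i)%:R) (fun i => (b i)%:R).

Lemma closed_grid_boundary a b : closed (grid_boundary a b).
Proof.
have -> : grid_boundary a b = grid_box a b `&`
    \bigcup_(i in [set i | (a i < b i)%N])
      ((fun x : 'rV[R]_n => x ord0 i) @^-1` [set (a i)%:R; (b i)%:R]).
  apply/seteqP; split => x -[bx].
    by move=> [i abi xi]; split=> //; exists i; rewrite /= -?(ltr_nat R).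
  by move=> [i abi xi]; split=> //; exists i; rewrite ?ltr_nat.
apply: closedI; first exact: closed_box.
apply: closed_bigcup => [|i _]; first exact: finite_finset.
apply: preimage_closed => [x _|]; first exact: coord_continuous.
by apply: closedU; exact: closed_eq.
Qed.

Definition set_coord (a : 'I_n -> nat) i c : 'I_n -> nat :=
  fun j => if j == i then c else a j.

Context (A B : set X) (lab : ('I_n -> nat) -> bool).

(** A point shared by several cells has to meet the requirement of each of them. On a common face of
    two cells with different labels the values lie in both [A] and [B]. *)
Definition grid_constraint (x : 'rV[R]_n) : set X :=
  [set y | forall k, grid_cell k x -> if lab k then A y else B y].

Definition grid_extends (a b : 'I_n -> nat) := forall f : 'rV[R]_n -> X,
  {within grid_boundary a b, continuous f} ->
  (forall x, grid_boundary a b x -> grid_constraint x (f x)) ->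
  exists g : 'rV[R]_n -> X, [/\ {within grid_box a b, continuous g},
    forall x, grid_box a b x -> grid_constraint x (g x) &
    forall x, grid_boundary a b x -> g x = f x].

Hypotheses (fillA : forall j, (j <= n)%N -> fillable R j A)
  (fillB : forall j, (j <= n)%N -> fillable R j B)
  (fillAB : forall j, (j < n)%N -> fillable R j (A `&` B)).

(** All sides have length 0 or 1, so the constraint is constant on the relative interior of the box:
    it is [A], [B] or their intersection, and a single filling of the box suffices. *)
Lemma grid_extends_unit a b : (forall i, a i <= b i <= (a i).+1)%N ->
  grid_extends a b.
Proof.
move=> ab f cf Cf.
(* the cells containing the whole box; every other cell misses its relative interior *)
pose P k := forall i, (k i <= a i)%N /\ (b i <= (k i).+1)%N.
have Pa : P a by move=> i; case/andP: (ab i) => _ ->.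
pose Y : set X := [set y | forall k, P k -> if lab k then A y else B y].
have Pcell k x : P k -> grid_box a b x -> grid_cell k x.
  move=> Pk bx i; have /andP[ax xb] := bx i; have [ka bk] := Pk i.
  by rewrite (le_trans _ ax) ?(le_trans xb) ?ler_nat.
have fY x : grid_boundary a b x -> Y (f x).
  by move=> bdx k Pk; apply: (Cf _ bdx); apply: Pcell => //; case: bdx.
have Cint x k : grid_box a b x -> ~ grid_boundary a b x -> grid_cell k x -> P k.
  move=> bx nbd kx i; have /andP[ax xb] := bx i; have /andP[kx1 kx2] := kx i.
  have [abi|] := ltnP (a i) (b i).
    have ax' : (a i)%:R < x ord0 i.
      rewrite lt_neqAle ax andbT; apply/eqP => axi; apply: nbd; split => //.
      by exists i; [rewrite ltr_nat|left].
    have xb' : x ord0 i < (b i)%:R.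
      rewrite lt_neqAle xb andbT; apply/eqP => axi; apply: nbd; split => //.
      by exists i; [rewrite ltr_nat|right].
    have := lt_le_trans ax' kx2; have := le_lt_trans kx1 xb'; rewrite !ltr_nat.
    by have := ab i; lia.
  move=> ba; have := le_trans ax kx2; have := le_trans kx1 xb; rewrite !ler_nat.
  by have := ab i; lia.
have [g [cg Yg gf]] : exists g : 'rV[R]_n -> X, [/\ {within grid_box a b, continuous g},
    forall x, grid_box a b x -> Y (g x) & forall x, grid_boundary a b x -> g x = f x].
  apply: fill_box => //.
    by move=> i; rewrite ler_nat; case/andP: (ab i).
  set F := [set i | _]%SET.
  have Fn : (#|F| <= n)%N by rewrite -[leqRHS]card_ord max_card.
  have [allA|nA] := pselect (forall k, P k -> lab k).
    suff -> : Y = A by exact: fillA.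
    apply/seteqP; split => y /=; first by move=> /(_ a Pa); rewrite allA.
    by move=> Ay k /allA ->.
  have [allB|nB] := pselect (forall k, P k -> ~~ lab k).
    suff -> : Y = B by exact: fillB.
    apply/seteqP; split => y /=; first by move=> /(_ a Pa); rewrite (negbTE (allB a Pa)).
    by move=> By k /allB /negbTE ->.
  have {nA} [k Pk /negbTE lk] : exists2 k, P k & ~~ lab k.
    apply: contra_notP nA => H k Pk; apply: contra_notT H => lk.
    by exists k.
  have {nB} [l Pl ll] : exists2 l, P l & lab l.
    apply: contra_notP nB => H l Pl; apply: contra_notN H => ll.
    by exists l.
  (* Cells with different labels contain the box, so some direction is degenerate and the dimension
     drops below [n]: if every side had length 1, [a] would be the only cell containing the box. *)
  suff -> : Y = A `&` B.
    apply: fillAB; rewrite ltn_neqAle Fn andbT; apply: contraT.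
    rewrite negbK => /eqP Fe.
    have FT i : i \in F.
      suff -> : F = [set: 'I_n]%SET by rewrite inE.
      by apply/eqP; rewrite eqEcard finset.subsetT finset.cardsT card_ord Fe /=.
    have Pu k1 : P k1 -> k1 = a.
      move=> P1; apply: funext => i; have := FT i; rewrite inE ltr_nat.
      by have := P1 i; have := ab i; lia.
    by move: lk ll; rewrite (Pu k) // (Pu l) // => ->.
  apply/seteqP; split => y /=.
    by move=> H; have := H k Pk; have := H l Pl; rewrite ll lk.
  by move=> [Ay By] j _; case: ifP.
exists g; split => // x bx k kx.
have [bdx|nbdx] := pselect (grid_boundary a b x); first by rewrite gf //; exact: Cf.
by apply: Yg => //; exact: Cint nbdx kx.
Qed.

Lemma grid_box_set_coordl a b i c : (a i <= c)%N ->
  forall x, grid_box (set_coord a i c) b x <-> grid_box a b x /\ c%:R <= x ord0 i.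
Proof.
move=> ac x; split.
  move=> bx; have := bx i; rewrite /set_coord eqxx => /andP[cx xb].
  split => // j; have := bx j; rewrite /set_coord; case: eqP => [->|//].
  by move=> _; rewrite (le_trans _ cx) ?ler_nat.
move=> [bx cx] j; rewrite /set_coord; case: eqP => [->|_]; last exact: bx.
by rewrite cx; have /andP[] := bx i.
Qed.

Lemma grid_box_set_coordr a b i c : (c <= b i)%N ->
  forall x, grid_box a (set_coord b i c) x <-> grid_box a b x /\ x ord0 i <= c%:R.
Proof.
move=> cb x; split.
  move=> bx; have := bx i; rewrite /set_coord eqxx => /andP[ax xc].
  split => // j; have := bx j; rewrite /set_coord; case: eqP => [->|//].
  by move=> _; rewrite ax (le_trans xc) ?ler_nat.
move=> [bx xc] j; rewrite /set_coord; case: eqP => [->|_]; last exact: bx.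
by rewrite xc; have /andP[-> _] := bx i.
Qed.

Lemma sum_side_lt (a b a' b' : 'I_n -> nat) i :
  (forall j, j != i -> a' j = a j /\ b' j = b j) ->
  (b' i - a' i < b i - a i)%N ->
  (\sum_j (b' j - a' j) < \sum_j (b j - a j))%N.
Proof.
move=> e lt; rewrite (bigD1 i) //= [ltnRHS](bigD1 i) //=.
rewrite (eq_bigr (fun j => (b j - a j)%N)) ?ltn_add2r // => j /e[-> ->] //.
Qed.

(** The box is cut along the hyperplane where coordinate [i] equals [c]. The map is extended first
    over the slice, then over the two halves, whose boundaries lie in the union of the old boundary
    and the slice. *)
Lemma grid_extends_split a b i c : (a i < c < b i)%N ->
  grid_extends (set_coord a i c) (set_coord b i c) ->
  grid_extends a (set_coord b i c) -> grid_extends (set_coord a i c) b ->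
  grid_extends a b.
Proof.
move=> /andP[ac cb] ES E1 E2 f cf Cf.
have acR : (a i)%:R < c%:R :> R by rewrite ltr_nat.
have cbR : c%:R < (b i)%:R :> R by rewrite ltr_nat.
have inS x : grid_box (set_coord a i c) (set_coord b i c) x <->
    grid_box a b x /\ x ord0 i = c%:R.
  rewrite grid_box_set_coordl ?grid_box_set_coordr /set_coord ?eqxx
    ?(ltnW cb) ?(ltnW ac) //.
  split; first by move=> [[bx xc] cx]; split => //; apply/le_anti; rewrite xc.
  by move=> [bx ->].
have in1 := grid_box_set_coordr a (ltnW cb).
have in2 := grid_box_set_coordl b (ltnW ac).
(* A point on a face in a direction other than [i] stays on the boundary of the slice and of each
   half that contains it. *)
have bdI : forall (x : 'rV[R]_n) (j : 'I_n), grid_box a b x -> j != i -> (a j < b j)%N ->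
    x ord0 j = (a j)%:R \/ x ord0 j = (b j)%:R -> [/\
    (x ord0 i = c%:R -> grid_boundary (set_coord a i c) (set_coord b i c) x),
    (x ord0 i <= c%:R -> grid_boundary a (set_coord b i c) x) &
    (c%:R <= x ord0 i -> grid_boundary (set_coord a i c) b x)].
  move=> x j bx ji abj xj; split => xi; split; rewrite -/(grid_box _ _);
    do ?[exact/inS|exact/in1|exact/in2];
    by exists j; rewrite /set_coord (negbTE ji) ?ltr_nat.
have bdS x : grid_boundary (set_coord a i c) (set_coord b i c) x ->
    grid_boundary a b x.
  move=> [/inS[bx xi] [j]]; rewrite /set_coord; case: eqP => [_|_ abj xj].
    by rewrite ltxx.
  by split => //; exists j.
have [||gS [cS CS Sf]] := ES f.
- exact: continuous_subspaceW cf.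
- by move=> x /bdS /Cf.
(* Since [c] lies strictly between the ends of side [i], a boundary point on the slice lies on a
   face in another direction, where [gS] is prescribed by [f]. *)
have agree x : grid_boundary a b x -> x ord0 i = c%:R -> gS x = f x.
  move=> [bx [j abj xj]] xi; rewrite Sf //.
  have ji : j != i by apply/eqP => ji; move: xj; rewrite ji xi; case; lra.
  by have [|/(_ xi)] := bdI x j bx ji _ xj; rewrite -?(ltr_nat R).
pose f1 (x : 'rV[R]_n) := if x ord0 i == c%:R then gS x else f x.
pose S := grid_box (set_coord a i c) (set_coord b i c).
have f1S x : S x -> f1 x = gS x by move=> /inS[_ xi]; rewrite /f1 xi eqxx.
have f1f x : grid_boundary a b x -> f1 x = f x.
  by move=> bdx; rewrite /f1; case: eqP => // /(agree _ bdx).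
have cf1 : {within grid_boundary a b `|` S, continuous f1}.
  apply: withinU_continuous; [exact: closed_grid_boundary|exact: closed_box| |].
    by apply: eq_within cf => x /f1f.
  by apply: eq_within cS => x /f1S.
have Cf1 x : (grid_boundary a b `|` S) x -> grid_constraint x (f1 x).
  by case=> [bdx|Sx]; [rewrite f1f //; exact: Cf|rewrite f1S //; exact: CS].
have bd1 : grid_boundary a (set_coord b i c) `<=` grid_boundary a b `|` S.
  move=> x [/in1[bx xc] [j]]; rewrite /set_coord; case: eqP => [->|_] abj xj.
    case: xj => xi; last by right; apply/inS.
    by left; split => //; exists i; [lra|left].
  by left; split => //; exists j.
have bd2 : grid_boundary (set_coord a i c) b `<=` grid_boundary a b `|` S.
  move=> x [/in2[bx xc] [j]]; rewrite /set_coord; case: eqP => [->|_] abj xj.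
    case: xj => xi; first by right; apply/inS.
    by left; split => //; exists i; [lra|right].
  by left; split => //; exists j.
have [||g1 [c1 C1 g1f]] := E1 f1.
- exact: continuous_subspaceW cf1.
- by move=> x /bd1 /Cf1.
have [||g2 [c2 C2 g2f]] := E2 f1.
- exact: continuous_subspaceW cf1.
- by move=> x /bd2 /Cf1.
(* The slice is a face of both halves, so both extensions restrict there to the same map [f1]. *)
have g12 x : grid_box a b x -> x ord0 i = c%:R -> g1 x = g2 x.
  move=> bx xi; rewrite g1f ?g2f //; split.
  - by apply/in2; rewrite xi.
  - by exists i; rewrite /set_coord eqxx //; left.
  - by apply/in1; rewrite xi.
  - by exists i; rewrite /set_coord eqxx //; right.
pose g (x : 'rV[R]_n) := if x ord0 i <= c%:R then g1 x else g2 x.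
have gg1 x : grid_box a (set_coord b i c) x -> g x = g1 x.
  by move=> /in1[_]; rewrite /g => ->.
have gg2 x : grid_box (set_coord a i c) b x -> g x = g2 x.
  move=> /in2[bx cx]; rewrite /g; case: ifP => // xc; apply: g12 => //.
  by apply/le_anti; rewrite xc.
have boxU : grid_box a b `<=`
    grid_box a (set_coord b i c) `|` grid_box (set_coord a i c) b.
  by move=> x bx; have [xc|/ltW xc] := leP (x ord0 i) c%:R;
    [left; apply/in1|right; apply/in2].
exists g; split.
- apply: (continuous_subspaceW boxU).
  apply: withinU_continuous; [exact: closed_box|exact: closed_box| |].
    by apply: eq_within c1 => x /gg1.
  by apply: eq_within c2 => x /gg2.
- by move=> x /boxU[] bx; [rewrite gg1 //; exact: C1|rewrite gg2 //; exact: C2].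
- move=> x [bx [j abj xj]].
  have bdx : grid_boundary a b x by split => //; exists j.
  have [ji|ji] := eqVneq j i.
    move: xj; rewrite ji => -[] xi.
      have b1x : grid_box a (set_coord b i c) x by apply/in1; split=> //; rewrite xi ltW.
      rewrite gg1 // g1f ?f1f //; split => //.
      by exists i; rewrite /set_coord eqxx //; left.
    have b2x : grid_box (set_coord a i c) b x by apply/in2; split=> //; rewrite xi ltW.
    rewrite gg2 // g2f ?f1f //; split => //.
    by exists i; rewrite /set_coord eqxx //; right.
  have [|_ H1 H2] := bdI x j bx ji _ xj; first by rewrite -(ltr_nat R).
  have [xc|xc] := leP (x ord0 i) c%:R.
    by rewrite gg1 ?g1f ?f1f //; [exact: H1|apply/in1].
  by rewrite gg2 ?g2f ?f1f //; [exact/H2/ltW|apply/in2; split => //; exact: ltW].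
Qed.

(** Induction on the sum of the side lengths: a side of length at least 2 is cut one unit above its
    lower end, and the slice and both halves have a smaller sum. *)
Lemma grid_extends_all a b : (forall i, a i <= b i)%N -> grid_extends a b.
Proof.
have [m] := ubnP (\sum_i (b i - a i))%N.
elim: m a b => // m IHm a b; rewrite ltnS => mab ab.
have [small|] := pselect (forall i, (b i <= (a i).+1)%N).
  by apply: grid_extends_unit => i; rewrite ab small.
move=> /existsNP[i /negP]; rewrite -ltnNge => abi.
have lt a' b' : (forall j, j != i -> a' j = a j /\ b' j = b j) ->
    (b' i - a' i < b i - a i)%N -> (\sum_j (b' j - a' j) < m)%N.
  by move=> e /(sum_side_lt e)/leq_trans; apply.
have e1 c j : j != i -> set_coord a i c j = a j by rewrite /set_coord => /negbTE ->.
have e2 c j : j != i -> set_coord b i c j = b j by rewrite /set_coord => /negbTE ->.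
apply: (@grid_extends_split _ _ i (a i).+1); first by rewrite leqnn.
all: apply: IHm;
  [apply: lt => [j ji|]; [by rewrite ?e1 ?e2|rewrite /set_coord ?eqxx; lia]|].
all: move=> j; have := ab j; rewrite /set_coord; case: eqP => [->|] //; lia.
Qed.

End Subdivision.

(** * From fine grids to the union of two open sets *)

Section Glueing.
Context (R : realType) (X : topologicalType).

(** Lebesgue's number lemma for the preimages of [A] and [B]. If a ball of radius [d] is good around
    [x], then every radius below [d / 2] is good around all points within [d / 2] of [x], and
    compactness makes one radius good everywhere. *)
Lemma lebesgue_number n (A B : set X) (f : 'rV[R]_n -> X) : open A -> open B ->
  {within @cube_boundary R n, continuous f} ->
  (forall x, cube_boundary x -> (A `|` B) (f x)) ->
  exists2 e : R, 0 < e & forall x, cube_boundary x ->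
    (forall y, cube_boundary y -> `|x - y| < e -> A (f y)) \/
    (forall y, cube_boundary y -> `|x - y| < e -> B (f y)).
Proof.
move=> oA oB /subspace_continuousP cf ABf.
have /compact_near_coveringP H := @compact_cube_boundary R n.
pose P e x := (forall y, cube_boundary y -> `|x - y| < e -> A (f y)) \/
    (forall y, cube_boundary y -> `|x - y| < e -> B (f y)).
have near_in (C : set X) x : open C -> cube_boundary x -> C (f x) ->
    \forall x' \near x & e \near 0^'+,
      forall y, cube_boundary y -> `|x' - y| < e -> C (f y).
  move=> oC Sx Cfx.
  have : within (@cube_boundary R n) (nbhs x) (f @^-1` C).
    exact: (cf _ Sx C (open_nbhs_nbhs (conj oC Cfx))).
  rewrite /within /= => /nbhs_ballP[d /= d0 dC].
  have d2 : 0 < d / 2 by rewrite divr_gt0.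
  exists (ball x (d / 2), [set e | e < d / 2]).
    by split => /=; [exact: nbhsx_ballx|exact: nbhs_right_lt].
  move=> [x' e] /= [xx' ed] y Sy x'y; apply: dC => //.
  move: xx'; rewrite -!ball_normE /= => xx'.
  by have := ler_distD x' x y; lra.
have : \forall e \near 0^'+, @cube_boundary R n `<=` P e.
  apply: H => x Sx; have [Afx|Bfx] := ABf _ Sx.
    by apply: filterS (near_in _ _ oA Sx Afx) => -[x' e]; left.
  by apply: filterS (near_in _ _ oB Sx Bfx) => -[x' e]; right.
move=> He.
have [e [e0 Pe]] : exists e : R, 0 < e /\ @cube_boundary R n `<=` P e.
  apply: (filter_ex (F := (0 : R)^'+)).
  by apply: filterS2 (nbhs_right_gt (0 : R)) He => e.
by exists e.
Qed.

Lemma fillableU n (A B : set X) : open A -> open B ->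
  (forall j, (j <= n)%N -> fillable R j A) ->
  (forall j, (j <= n)%N -> fillable R j B) ->
  (forall j, (j < n)%N -> fillable R j (A `&` B)) ->
  fillable R n (A `|` B).
Proof.
move=> oA oB fA fB fAB; split.
  by have [[x Ax] _] := fA _ (leqnn n); exists x; left.
move=> f cf ABf; have [e e0 He] := lebesgue_number oA oB cf ABf.
(* The cube has side 2, so [N] cells per direction have diameter 2/N in the sup norm, below the
   Lebesgue number. *)
have [N N0 Ne] : exists2 N, (0 < N)%N & 2 / N%:R < e.
  exists (Num.truncn (2 / e)).+1 => //.
  rewrite ltr_pdivrMr ?ltr0n // -ltr_pdivrMl // mulrC.
  exact: truncnS_gt.
pose c : R := N%:R / 2.
have NR : 0 < N%:R :> R by rewrite ltr0n.
have c0 : 0 < c by rewrite divr_gt0.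
pose shrink (x : 'rV[R]_n) : 'rV[R]_n := \row_i (x ord0 i / c - 1).
pose expand (y : 'rV[R]_n) : 'rV[R]_n := \row_i ((y ord0 i + 1) * c).
pose a (i : 'I_n) := 0%N; pose b (i : 'I_n) := N.
have expandK : cancel expand shrink.
  by move=> y; apply/rowP => i; rewrite !mxE; field; rewrite gt_eqF.
have cshrink D : {within D, continuous shrink}.
  apply: within_row => i; under eq_fun do rewrite mxE.
  apply: withinB; last exact: within_cst.
  by apply: withinM; [exact: within_coord_id|exact: within_cst].
have cexpand D : {within D, continuous expand}.
  apply: within_row => i; under eq_fun do rewrite mxE.
  apply: withinM; last exact: within_cst.
  by apply: withinD; [exact: within_coord_id|exact: within_cst].
have shrink_cube x : grid_box a b x -> cube (shrink x).
  move=> bx; apply/row_norm_le => // i; rewrite mxE ler_norml.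
  have /andP[x0 xN] := bx i.
  have : 0 <= x ord0 i / c by rewrite divr_ge0 // ltW.
  have : x ord0 i / c <= 2 by rewrite ler_pdivrMr // /c; rewrite /b in xN; lra.
  by lra.
have shrink_boundary x : grid_boundary a b x -> cube_boundary (shrink x).
  move=> [bx [i _ xi]]; apply/cube_boundaryP; split; first exact: shrink_cube.
  exists i; rewrite mxE; case: xi => ->.
    by rewrite mul0r sub0r normrN normr1.
  have -> : (b i)%:R / c - 1 = 1 by rewrite /b /c; field; rewrite gt_eqF.
  by rewrite normr1.
have expand_cube y : cube y -> grid_box a b (expand y).
  move=> /row_norm_le cy i; have := cy ler01 i; rewrite mxE ler_norml.
  move=> /andP[y1 y2]; rewrite mulr_ge0 ?(ltW c0) //=; last lra.
  by rewrite -ler_pdivlMr // /b /c invf_div mulrCA divff ?gt_eqF // mulr1; lra.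
have expand_boundary y : cube_boundary y -> grid_boundary a b (expand y).
  move=> /cube_boundaryP[cy [i yi]]; split; first exact: expand_cube.
  exists i; first by rewrite ltr_nat.
  rewrite mxE; have [y0|y0] := leP 0 (y ord0 i).
    by right; move: yi; rewrite ger0_norm // => ->; rewrite /b /c; field.
  by left; move: yi; rewrite ltr0_norm // => /(canRL (@opprK _)) ->; rewrite addNr mul0r.
(* A cell gets label [A] when all its boundary points are sent into [A], in particular when it
   misses the boundary. Otherwise some boundary point [y] of the cell is sent outside [A], and the
   smallness of the cell forces all its boundary points into [B]. *)
pose lab (k : 'I_n -> nat) : bool := `[< forall x, grid_boundary a b x ->
  grid_cell k x -> A (f (shrink x)) >].
have [|||g [cg Cg gf]] := @grid_extends_all R X n A B lab fA fB fAB a b _ (f \o shrink).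
- by [].
- exact: (@within_compose _ _ _ _ _ shrink f (@cshrink _) cf shrink_boundary).
- move=> x bdx k kx; case: ifPn => [/asboolP|/asboolPn]; first exact.
  move=> /existsNP[y /not_implyP[bdy /not_implyP[ky nAy]]].
  have close z : grid_cell k z -> `|shrink y - shrink z| < e.
    move=> kz; apply: le_lt_trans Ne; apply/row_norm_le.
      by rewrite divr_ge0 // ltW.
    move=> i; rewrite !mxE.
    have -> : y ord0 i / c - 1 - (z ord0 i / c - 1) = (y ord0 i - z ord0 i) * (2 / N%:R).
      by rewrite /c; field; rewrite gt_eqF.
    rewrite normrM [X in _ * X]ger0_norm ?divr_ge0 ?(ltW NR) //.
    rewrite -[leRHS]mul1r ler_wpM2r ?divr_ge0 ?(ltW NR) //.
    have := ky i; have := kz i; rewrite ler_norml -natr1; lra.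
  have [HA|HB] := He _ (shrink_boundary _ bdy).
    by case: nAy; apply: HA; [exact: shrink_boundary|exact: close].
  by apply: HB; [exact: shrink_boundary|exact: close].
exists (g \o expand); split.
- exact: (@within_compose _ _ _ _ _ expand g (@cexpand _) cg expand_cube).
- move=> y /expand_cube bx; have := Cg _ bx.
  (* Integer parts, capped at the last cell of the grid, give a cell containing the point; its label
     tells which of the two sets contains the value. *)
  pose k (i : 'I_n) := minn (Num.truncn (expand y ord0 i)) N.-1.
  move=> /(_ k); rewrite /= => Hk.
  have : if lab k then A (g (expand y)) else B (g (expand y)).
    apply: Hk => i; have /andP[x0 xN] := bx i; rewrite /k.
    have /andP[t1 t2] := truncn_itv x0.
    apply/andP; split; first by rewrite (le_trans _ t1) ?ler_nat ?geq_minl.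
    rewrite /minn; case: ifP => _; first exact: ltW.
    by rewrite prednK.
  by case: ifP; [left|right].
- by move=> y Sy; rewrite /= gf /= ?expandK //; exact: expand_boundary.
Qed.

End Glueing.

(** * Unions of open sets *)

Lemma set_consU1 (I : eqType) (i : I) t : [set` i :: t] = i |` [set` t].
Proof.
apply/seteqP; split => j /=; first by rewrite in_cons => /orP[/eqP|]; [left|right].
by rewrite in_cons; case=> [->|->]; rewrite ?eqxx ?orbT.
Qed.

Section Unions.
Context (R : realType) (X : topologicalType).

(* [fillable_below m] is (m-2)-connectedness. *)
Definition fillable_below m (A : set X) := forall n, (n < m)%N -> fillable R n A.

(** Induction on [s], gluing the first set to the union of the others. When [size t] exceeds [m] the
    truncated difference is 0 and the hypothesis on [t] is vacuous. *)
Lemma fillable_below_bigcup m (I : choiceType) (s : seq I) (F : I -> set X) :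
  s != [::] -> (forall i, open (F i)) ->
  (forall t, subseq t s -> t != [::] ->
     fillable_below (m.+1 - size t) (\bigcap_(i in [set` t]) F i)) ->
  fillable_below m (\bigcup_(i in [set` s]) F i).
Proof.
elim: s m F => // i s IHs m F _ oF H.
have fi : fillable_below m (F i).
  have := H [:: i]; rewrite /= eqxx sub0seq subn1 /= => /(_ isT isT).
  by rewrite set_cons1 bigcap_set1.
have [s0|s0] := eqVneq s [::]; first by rewrite s0 set_cons1 bigcup_set1; exact: fi.
have -> : \bigcup_(j in [set` i :: s]) F j = F i `|` \bigcup_(j in [set` s]) F j.
  by rewrite set_consU1 bigcup_setU1.
have fs : fillable_below m (\bigcup_(j in [set` s]) F j).
  apply: IHs => // t ts t0; apply: H => //.
  exact: subseq_trans ts (subseq_cons _ _).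
(* The intersection of [F i] with the rest is the union of the sets of the form [F i] intersected
   with [F j]. Their intersection over [t] is the original one over [i :: t], so the bound drops by
   one, as gluing allows. *)
have fis : fillable_below m.-1 (F i `&` \bigcup_(j in [set` s]) F j).
  case: m H {IHs fi fs} (IHs m.-1) => [|m] H IHs; first by [].
  rewrite setI_bigcupr; apply: IHs => //= [j|t ts t0]; first exact: openI.
  have := H (i :: t); rewrite /= eqxx ts subSS => /(_ isT isT).
  rewrite set_consU1 bigcap_setU1.
  suff -> : F i `&` \bigcap_(j in [set` t]) F j =
      \bigcap_(j in [set` t]) (F i `&` F j) by [].
  apply/seteqP; split => x.
    by move=> [Fi Fj] j jt; split => //; exact: Fj.
  move=> Fij; split=> [|j /Fij[]//].
  by case: t t0 Fij {ts} => // j t _ /(_ j); rewrite /= mem_head => /(_ isT)[].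
move=> n nm; apply: fillableU => //.
- exact: bigcup_open.
- by move=> j jn; apply: fi; exact: leq_ltn_trans nm.
- by move=> j jn; apply: fs; exact: leq_ltn_trans nm.
- move=> j jn; apply: fis; lia.
Qed.

End Unions.

(** * Geometric realisations *)

Section Realization.
Context (R : realType) (V : choiceType) (K : simplicial_complex V).
Local Notation X := (realization R K).

Lemma bary_inj (x y : X) : bary x =1 bary y -> x = y.
Proof.
case: x y => [x xP] [y yP] /= /funext exy; case: _ / exy in yP *.
by congr Realization; exact: Prop_irrelevance.
Qed.

Lemma bary_ge0 (x : X) v : 0 <= x v.
Proof. by have [s _ []] := baryP x. Qed.

Lemma geometric_simplex_supp (x : X) (s : {fset V}) :
  (forall v, v \notin s -> x v = 0) -> geometric_simplex s x.
Proof.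
move=> x0; have [t _ [_ t0 t1]] := baryP x; split=> //; first exact: bary_ge0.
rewrite -t1; transitivity (\sum_(v <- (s `|` t)%fset) x v).
  by apply: big_fset_incl => [|v _]; [exact: fsubsetUl|exact: x0].
symmetry; apply: big_fset_incl => [|v _]; [exact: fsubsetUr|exact: t0].
Qed.

Lemma bary_le1 (x : X) v : x v <= 1.
Proof.
have [s _ [x0 xs <-]] := baryP x; have [vs|/xs ->] := boolP (v \in s).
  by rewrite (big_fsetD1 v vs) /= lerDl sumr_ge0.
by rewrite sumr_ge0.
Qed.

Lemma sum_pos_ex (s : {fset V}) (F : V -> R) :
  0 < \sum_(v <- s) F v -> exists2 v, v \in s & 0 < F v.
Proof.
move=> s0; apply: contrapT => H; move: s0; apply/negP; rewrite -leNgt.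
rewrite big_seq; apply: sumr_le0 => v vs; rewrite leNgt; apply/negP => Fv.
by apply: H; exists v.
Qed.

Lemma support_simplex (x : X) :
  exists2 s, simplexes K s & forall v, (v \in s) = (0 < x v).
Proof.
have [s Ks [x0 xs s1]] := baryP x.
have e v : (v \in [fset v in s | 0 < x v]%fset) = (0 < x v).
  rewrite !inE /=; have [//|/xs ->] := boolP (v \in s).
  by rewrite ltxx.
exists [fset v in s | 0 < x v]%fset => //.
apply: (simplex_face Ks); first by apply/fsubsetP => v; rewrite !inE => /andP[].
have [|v vs xv] := @sum_pos_ex s x; first by rewrite s1.
by apply/fset0Pn; exists v; rewrite e.
Qed.

(** Normalises a weight supported on a simplex. Summing over a fixed [W] rather than over the
    support lets the sum depend continuously on the weight. *)
Lemma realization_of (W s : {fset V}) (h : V -> R) :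
  simplexes K s -> (forall v, (v \in s) = (0 < h v)) -> (forall v, 0 <= h v) ->
  (s `<=` W)%fset ->
  0 < \sum_(w <- W) h w /\
  exists x : X, forall v, x v = h v / \sum_(w <- W) h w.
Proof.
move=> Ks sE h0 sW.
have hs v : v \notin s -> h v = 0.
  by rewrite sE -leNgt => hv; apply/le_anti; rewrite hv h0.
have eW : \sum_(w <- W) h w = \sum_(w <- s) h w.
  by symmetry; apply: big_fset_incl => // v _; exact: hs.
have N0 : 0 < \sum_(w <- s) h w.
  have /fset0Pn[v vs] := simplex_neq0 Ks.
  rewrite (big_fsetD1 v vs) /= ltr_pwDl ?sumr_ge0 // -?sE //.
split; first by rewrite eW.
suff H : exists2 t, simplexes K t &
    geometric_simplex t (fun v => h v / \sum_(w <- W) h w).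
  by exists (Realization H).
exists s => //; rewrite eW; split.
- by move=> v; rewrite divr_ge0 // ltW.
- by move=> v /hs ->; rewrite mul0r.
- by rewrite -mulr_suml divff ?gt_eqF.
Qed.

Lemma ptws_forall_open (s : {fset V}) (P : s -> set R) : (forall v, open (P v)) ->
  open [set h : {ptws s -> R} | forall v, P v (h v)].
Proof.
move=> oP; rewrite openE => h Ph; rewrite /interior /=.
apply: (@filter_forall _ s (fun v (g : {ptws s -> R}) => P v (g v)) (nbhs h)) => v.
apply: (@proj_continuous s (fun=> R) v h); exact: open_nbhs_nbhs.
Qed.

Lemma ptws_cvg (I : choiceType) (T : Type) (F : set_system T) (FF : Filter F)
    (h : T -> {ptws I -> R}) (f : {ptws I -> R}) :
  (forall i, h y i @[y --> F] --> f i) -> h @ F --> f.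
Proof.
move=> hf; apply/cvg_sup => i A; rewrite nbhsE => -[B [[C oC CB] Bf] BA].
have : \forall y \near F, C (h y i).
  by apply: hf; apply: open_nbhs_nbhs; split => //; move: Bf; rewrite -CB.
by apply: filterS => y Cy; apply: BA; rewrite -CB.
Qed.

Lemma bary_continuous v : continuous (fun x : X => x v).
Proof.
apply/continuousP => O oO; change (coherent_open ((fun x : X => x v) @^-1` O)) => s Ks.
have [vs|vs] := boolP (v \in s).
  exists ((fun h : {ptws s -> R} => h [` vs]%fset) @^-1` O) => //.
  apply: open_comp => // h _; exact: (@proj_continuous s (fun=> R) _ h).
exists [set _ | O 0]; last by move=> x [_ /(_ _ vs) x0 _]; rewrite /= x0.
have [inO|ninO] := pselect (O 0).
  by rewrite (_ : [set _ | _] = setT); [exact: openT|apply/seteqP; split].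
by rewrite (_ : [set _ | _] = set0); [exact: open0|apply/seteqP; split].
Qed.

(** Even for infinite [S], only the finitely many constraints at vertices of [s] matter on |s|: the
    other coordinates vanish there and the bounds are positive. *)
Lemma open_bary_lt (S : set V) (c : V -> R) : (forall v, S v -> 0 < c v) ->
  open [set x : X | forall v, S v -> x v < c v].
Proof.
move=> c0; change (coherent_open [set x : X | forall v, S v -> x v < c v]) => s Ks.
pose P (v : s) := [set y : R | S (val v) -> y < c (val v)].
exists [set h : {ptws s -> R} | forall v, P v (h v)].
  apply: ptws_forall_open => v; rewrite /P; have [Sv|Sv] := pselect (S (val v)).
    rewrite (_ : [set y | _] = [set y | y < c (val v)]); first exact: open_lt.
    by apply/seteqP; split => y //= /(_ Sv).
  rewrite (_ : [set y | _] = setT); first exact: openT.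
  by apply/seteqP; split => // y _ /= /Sv.
move=> x [_ xs _]; split => [xc v Sv|xc v Sv]; first exact: xc.
have [vs|/xs ->] := boolP (v \in s); last exact: c0.
exact: (xc [` vs]%fset).
Qed.

(* For each vertex [v] used by [C] fix a point [p v] of [C] with [p v v > 0];
   the sets of points bounded by [p v v] at all used vertices outside a finite
   set form a directed open cover. *)
Lemma compact_finite_support (C : set X) : compact C ->
  exists W : {fset V}, forall x, C x -> forall v, v \notin W -> x v = 0.
Proof.
move=> /compact_near_coveringP cC.
pose S := [set v | exists2 x : X, C x & 0 < x v].
have [[x0 Cx0]|nC] := pselect (C !=set0); last first.
  by exists fset0 => x Cx; case: nC; exists x.
have /choice[p pP] : forall v, exists x : X, S v -> C x /\ 0 < x v.
  move=> v; have [[x Cx xv]|nS] := pselect (S v); first by exists x.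
  by exists x0.
pose U (F : {fset V}) := [set x : X | forall v, (S v /\ v \notin F) -> x v < p v v].
pose up := filter_from [set: {fset V}] (fun F => [set F' | (F `<=` F')%fset]).
have upF : Filter up.
  apply: filter_from_filter; first by exists fset0.
  move=> F G _ _; exists (F `|` G)%fset => // H /=.
  by rewrite fsubUset => /andP[].
have [x Cx|F _ FU] := cC _ up U upF.
  have [s Ks [_ xs _]] := baryP x.
  exists (U s, [set F | (s `<=` F)%fset]); last first.
    by move=> [y F] /= [Uy sF] v [Sv vF]; apply: Uy; split => //;
      apply: contra vF; exact: (fsubsetP sF).
  split; last by exists s.
  apply: open_nbhs_nbhs; split; first by apply: open_bary_lt => v [/pP[]].
  by move=> v [/pP[_ pv] /xs ->].
exists F => x Cx v vF; apply/eqP.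
rewrite eq_le bary_ge0 andbT leNgt; apply/negP => xv.
have Sv : S v by exists x.
have [Cp _] := pP _ Sv.
(* The point [p v] would have to satisfy its own strict bound at [v]. *)
by have := FU F (fsubset_refl F) _ Cp v (conj Sv vF); rewrite ltxx.
Qed.

(** The coherent topology may be finer than the topology of coordinatewise convergence, but supports
    inside a finite [W] involve only finitely many simplexes, and on each of them the two topologies
    agree. *)
Lemma within_realization (T : topologicalType) (D : set T) (W : {fset V}) (g : T -> X) :
  (forall y, D y -> forall v, v \notin W -> g y v = 0) ->
  (forall v, {within D, continuous (fun y => g y v)}) ->
  {within D, continuous g}.
Proof.
move=> gW cg; apply/subspace_continuousP => y Dy.
have cgy v : g y' v @[y' --> within D (nbhs y)] --> g y v.
  by have /subspace_continuousP/(_ y Dy) := cg v.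
move=> S; rewrite nbhsE => -[Q [oQ Qgy] QS].
(* For each finite [s] in [W]: if [g y] lies in |s|, the trace of [Q] on |s| controls nearby values;
   if not, some coordinate outside [s] is nonzero at [y], hence nearby, and nearby values avoid
   |s|. *)
have H : \forall y' \near within D (nbhs y), (\bigcap_(s in [set` fpowerset W])
    [set y' | simplexes K s -> geometric_simplex s (g y') -> Q (g y')]) y'.
  apply: filter_bigI => s _; have [Ks|nKs] := pselect (simplexes K s); last first.
    by apply: nearW => y' /=.
  have [gs|ngs] := pselect (geometric_simplex s (g y)).
    have [Os oOs OsP] := oQ s Ks.
    have c : (fun y' => (fun v : s => g y' (val v)) : {ptws s -> R}) @ within D (nbhs y) -->
        ((fun v : s => g y (val v)) : {ptws s -> R}).
      by apply: ptws_cvg => v; exact: cgy.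
    have nOs : nbhs ((fun v : s => g y (val v)) : {ptws s -> R}) Os.
      by apply: open_nbhs_nbhs; split => //; exact/OsP.
    have cOs : \forall y' \near within D (nbhs y), Os (fun v : s => g y' (val v)).
      exact: c _ nOs.
    by apply: filterS cOs => y' Oy' _ /OsP ->.
  have [v vs gv] : exists2 v, v \notin s & g y v != 0.
    apply: contrapT => H; apply: ngs; apply: geometric_simplex_supp => v vs.
    by apply/eqP/negPn/negP => gv; apply: H; exists v.
  have n0 : nbhs (g y v) [set z | z != 0].
    by apply: open_nbhs_nbhs; split => //; exact: open_neq.
  have cn0 : \forall y' \near within D (nbhs y), g y' v != 0 by exact: cgy n0.
  by apply: filterS cn0 => y' g0 _ [_ /(_ _ vs)] /eqP; rewrite (negbTE g0).
have DD : \forall y' \near within D (nbhs y), D y' by exact: withinT.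
apply: filterS2 DD H => y' Dy' H; apply: QS.
have [s Ks sE] := support_simplex (g y').
apply: (H s) => //=.
  rewrite fpowersetE; apply/fsubsetP => v; rewrite sE; apply: contraTT => /(gW _ Dy') ->.
  by rewrite ltxx.
apply: geometric_simplex_supp => v; rewrite sE -leNgt => gv.
by apply/le_anti; rewrite gv bary_ge0.
Qed.

End Realization.

(** * Thickenings *)

Section Thickening.
Context (R : realType) (V : choiceType) (K : simplicial_complex V).
Local Notation X := (realization R K).

(* Open, unlike |M|, hence suitable for gluing, and yet compatible with
   intersections of subcomplexes ([thickeningI]). *)
Definition thickening (M : set {fset V}) : set X :=
  [set x | exists2 s, M s & exists2 t : R, 0 < t &
     forall v, if v \in s then t < x v else x v < t].

(** A coordinate above a positive threshold cannot vanish, so on |s| only superlevel sets inside [s]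
    occur. Each such set with its threshold imposes strict inequalities on finitely many
    coordinates. *)
Lemma open_thickening M : open (thickening M).
Proof.
change (coherent_open (thickening M)) => s Ks.
pose P (u : {fset V}) (t : R) (v : s) :=
  if val v \in u then [set y : R | t < y] else [set y | y < t].
exists (\bigcup_(ut in [set ut : {fset V} * R | M ut.1 /\ (ut.1 `<=` s)%fset /\ 0 < ut.2])
    [set h : {ptws s -> R} | forall v, P ut.1 ut.2 v (h v)]).
  apply: bigcup_open => -[u t] _ /=; apply: ptws_forall_open => v; rewrite /P.
  by case: ifP => _; [exact: open_gt|exact: open_lt].
move=> x [_ xs _]; split.
  move=> [u Mu [t t0 ut]]; exists (u, t) => /=.
    2: by move=> v; have := ut (val v); rewrite /P; case: ifP.
  split => //; split => //; apply/fsubsetP => v vu; have := ut v; rewrite vu => xv.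
  by apply/negPn/negP => /xs x0; move: xv; rewrite x0 ltNge ltW.
move=> [[u t] /= [Mu [us t0]] H]; exists u => //; exists t => // v.
have [vs|vs] := boolP (v \in s).
  by have := H [` vs]%fset; rewrite /P /=; case: ifP.
by rewrite (xs _ vs) (negbTE (contra (fsubsetP us v) vs)).
Qed.

Lemma fset_pos_lower (s : {fset V}) (F : V -> R) :
  (forall v, v \in s -> 0 < F v) -> exists2 t : R, 0 < t & forall v, v \in s -> t < F v.
Proof.
move=> F0; exists (\big[Num.min/1]_(v : s) F (val v) / 2).
  by rewrite divr_gt0 //; apply/bigmin_gtP; split => // v _; exact/F0/valP.
move=> v vs; have /= := bigmin_le 1 [` vs]%fset (fun w : s => F (val w)).
by have := F0 _ vs; lra.
Qed.

Lemma thickening_support (M : set {fset V}) (x : X) s :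
  M s -> (forall v, (v \in s) = (0 < x v)) -> thickening M x.
Proof.
move=> Ms sE; have [v|t t0 tx] := @fset_pos_lower s x; first by rewrite sE.
exists s => //; exists t => // v; case: ifP => [/tx //|].
by move=> /negbT; rewrite sE -leNgt => /le_lt_trans; exact.
Qed.

Lemma thickening_complex : thickening (simplexes K) = setT.
Proof.
apply/seteqP; split => // x _; have [s Ks sE] := support_simplex x.
exact: thickening_support Ks sE.
Qed.

Lemma thickening_mono M N : M `<=` N -> thickening M `<=` thickening N.
Proof. by move=> MN x [s /MN Ns st]; exists s. Qed.

(* Superlevel sets of a point are nested. *)
Lemma thickeningI (M N : set {fset V}) :
  (forall s t, M s -> (t `<=` s)%fset -> t != fset0 -> M t) ->
  (forall s t, N s -> (t `<=` s)%fset -> t != fset0 -> N t) ->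
  (forall s, M s -> s != fset0) -> (forall s, N s -> s != fset0) ->
  thickening M `&` thickening N = thickening (M `&` N).
Proof.
move=> fM fN M0 N0; apply/seteqP; split; last first.
  by move=> x Hx; split; apply: thickening_mono Hx => s [].
move=> x [[s Ms [t t0 sx]] [s' Ns' [t' t0' sx']]].
have [tt'|t't] := leP t t'.
  have ss : (s' `<=` s)%fset.
    apply/fsubsetP => v vs'; have := sx' v; have := sx v; rewrite vs'; case: ifP => //.
    by lra.
  by exists s'; [split => //; exact: fM ss (N0 _ _)|exists t'].
have ss : (s `<=` s')%fset.
  apply/fsubsetP => v vs; have := sx' v; have := sx v; rewrite vs; case: ifP => //.
  by lra.
by exists s; [split => //; exact: fN ss (M0 _ _)|exists t].
Qed.

End Thickening.

(** * Cones *)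

Lemma within_bigmax (R : realType) (T : topologicalType) (D : set T) (I : Type)
    (s : seq I) (P : pred I) (c : T -> R) (F : I -> T -> R) :
  {within D, continuous c} -> (forall i, {within D, continuous (F i)}) ->
  {within D, continuous (fun x => \big[Num.max/c x]_(i <- s | P i) F i x)}.
Proof.
move=> cc cF; elim: s => [|i s IHs]; first by under eq_fun do rewrite big_nil.
under eq_fun do rewrite big_cons; case: (P i) => //; exact: within_max.
Qed.

Lemma within_bigmin (R : realType) (T : topologicalType) (D : set T) (I : Type)
    (s : seq I) (P : pred I) (c : T -> R) (F : I -> T -> R) :
  {within D, continuous c} -> (forall i, {within D, continuous (F i)}) ->
  {within D, continuous (fun x => \big[Num.min/c x]_(i <- s | P i) F i x)}.
Proof.
move=> cc cF; elim: s => [|i s IHs]; first by under eq_fun do rewrite big_nil.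
under eq_fun do rewrite big_cons; case: (P i) => //; exact: within_min.
Qed.

Lemma within_row_norm (R : realType) n (D : set 'rV[R]_n) :
  {within D, continuous (fun z : 'rV[R]_n => `|z|)}.
Proof. apply: continuous_subspaceT => z; exact: norm_continuous. Qed.

(** At the origin the bound on [c] makes the product at most the norm of [z]. Away from it the
    function is composed of continuous maps. *)
Lemma within_radial (R : realType) n (c : 'rV[R]_n -> R) :
  {within @cube_boundary R n, continuous c} ->
  (forall y, cube_boundary y -> `|c y| <= 1) ->
  {within @cube R n, continuous (fun z => `|z| * c (`|z|^-1 *: z))}.
Proof.
move=> cc c1; set f := fun z => _.
have bd (z : 'rV[R]_n) : z != 0 -> cube_boundary (`|z|^-1 *: z).
  by move=> z0; rewrite /cube_boundary /= normrZ normfV normr_id mulVf ?normr_eq0.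
apply/subspace_continuousP => z _; have [->|z0] := eqVneq z 0.
  apply/cvgrPdist_lt => e e0; apply: cvg_within.
  have : \forall y \near (0 : 'rV[R]_n), `|y| < e.
    by apply/nbhs_ballP; exists e => //= y; rewrite -ball_normE /= sub0r normrN.
  have f0 : f 0 = 0 by rewrite /f normr0 mul0r.
  apply: filterS => y ye; rewrite /from_subspace f0 sub0r normrN.
  apply: le_lt_trans ye; rewrite /f; have [->|y0] := eqVneq y 0.
    by rewrite normr0 mul0r normr0.
  by rewrite normrM normr_id ler_piMr // c1 //; exact: bd.
have n0 : \forall y \near z, y != 0.
  have : \forall y \near z, `|y| != 0.
    apply: (@norm_continuous _ _ z [set r | r != 0]).
    by apply: open_nbhs_nbhs; split; [exact: open_neq|rewrite /= normr_eq0].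
  by apply: filterS => y; rewrite normr_eq0.
have /subspace_continuousP/(_ z z0) cf : {within [set y : 'rV[R]_n | y != 0], continuous f}.
  apply: withinM; first exact: within_row_norm.
  apply: (@within_compose _ _ _ _ _ (fun y : 'rV[R]_n => `|y|^-1 *: y) c _ cc bd).
  apply: within_row => i.
  rewrite (_ : (fun _ => _) = (fun y : 'rV[R]_n => `|y|^-1 * y ord0 i)); last first.
    by apply/funext => y; rewrite mxE.
  apply: withinM; last exact: within_coord_id.
  by apply: withinV => [y|]; [rewrite normr_eq0|exact: within_row_norm].
move=> S /cf HS.
have {}HS : \forall y \near z, y != 0 -> S (f y) by exact: HS.
by apply: filterS2 n0 HS => y y0 Sf _; exact: Sf.
Qed.

Section Cone.
Context (R : realType) (V : choiceType) (K : simplicial_complex V).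
Local Notation X := (realization R K).
Context (M : set {fset V}) (v0 : V).
Hypotheses (MK : M `<=` simplexes K)
  (M_face : forall s t, M s -> (t `<=` s)%fset -> t != fset0 -> M t)
  (M_apex : M [fset v0]%fset) (M_cone : forall s, M s -> M (v0 |` s)%fset).

(** * Contraction to the apex at one point, with [rho] the radius and [phi] the scaled
    coordinates *)

Section Pointwise.
Context (W : {fset V}) (rho : R) (phi : V -> R).

(* A set of vertices on which [phi] exceeds this level lies in [M]. *)
Definition cone_level : R :=
  \big[Num.max/0]_(T : fpowerset W | `[< ~ M (val T) >] && (val T != fset0))
     \big[Num.min/rho]_(u : val T) phi (val u).

(* As rho decreases from 1 to 1/2 the point is pushed into |M| by lowering its
   coordinates by the level; from 1/2 to 0 it slides to the apex. *)
Definition cone_coord u : R :=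
  Num.max 0 (phi u - Num.min 1 (2 * (1 - rho)) * cone_level) +
  Num.max 0 (1 - 2 * rho) * (u == v0)%:R.

Hypotheses (rho0 : 0 <= rho) (rho1 : rho <= 1) (phi0 : forall u, 0 <= phi u)
  (phi_le : forall u, phi u <= rho) (phiW : forall u, u \notin W -> phi u = 0)
  (v0W : v0 \in W).

Let B := cone_level.

Let B_ge0 : 0 <= B. Proof. exact: bigmax_ge_id. Qed.

Let B_face (S : {fset V}) : (S `<=` W)%fset -> S != fset0 ->
  (forall u, u \in S -> B < phi u) -> M S.
Proof.
move=> SW S0 SB; apply: contrapT => nMS.
have SP : S \in fpowerset W by rewrite fpowersetE.
have : \big[Num.min/rho]_(u : S) phi (val u) <= B.
  rewrite /B /cone_level; apply: (@le_bigmax_cond _ _ _ 0 [` SP]%fset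
    (fun T : fpowerset W => `[< ~ M (val T) >] && (val T != fset0))
    (fun T : fpowerset W => \big[Num.min/rho]_(u : val T) phi (val u))) => /=.
  by rewrite S0 andbT; exact/asboolP.
apply/negP; rewrite -ltNge; apply/bigmin_gtP; split.
  by case/fset0Pn: S0 => u /SB /lt_le_trans; exact.
by move=> u _; apply: SB; exact: valP.
Qed.

(** A nonempty set outside [M] is not contained in [s], because [M] is closed under faces. It thus
    has a vertex where [phi] is below [rho * t], which bounds every minimum entering the level. *)
Let B_lt (x : X) s t : 0 < rho -> (forall u, phi u = rho * x u) -> M s -> 0 < t ->
  (forall v, if v \in s then t < x v else x v < t) -> B < rho * t.
Proof.
move=> r0 phix Ms t0 st; apply/bigmax_ltP; split; first exact: mulr_gt0.
move=> T /andP[/asboolP nMT T0].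
have [u uT us] : exists2 u, u \in val T & u \notin s.
  apply: contrapT => H; apply: nMT; apply: M_face Ms _ T0.
  by apply/fsubsetP => u uT; apply/negPn/negP => us; apply: H; exists u.
apply: le_lt_trans (bigmin_le rho [` uT]%fset (fun w : val T => phi (val w))) _.
by rewrite /= phix ltr_pM2l //; have := st u; rewrite (negbTE us).
Qed.

Lemma cone_coord_out u : u \notin W -> cone_coord u = 0.
Proof.
move=> uW; have uv : u != v0 by apply: contraNneq uW => ->.
rewrite /cone_coord phiW // (negbTE uv) mulr0 addr0 sub0r max_l // oppr_le0.
by rewrite mulr_ge0 // le_min ler01 mulr_ge0 // subr_ge0.
Qed.

(** In the inner half the support itself is a simplex of [M]. In the outer half the superlevel set
    [s] survives with a lowered threshold, positive by [B_lt]. The alternative [rho = 0] is the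
    centre, to which no point of the thickening is attached. *)
Lemma cone_pointwise :
  rho = 0 \/ (exists2 x : X, thickening M x & forall u, phi u = rho * x u) ->
  0 < \sum_(w <- W) cone_coord w /\
  exists2 y : X, thickening M y &
    forall u, y u = cone_coord u / \sum_(w <- W) cone_coord w.
Proof.
move=> Hx; set h := cone_coord.
set tau := Num.min 1 (2 * (1 - rho)); set lam := Num.max 0 (1 - 2 * rho).
have hE u : h u = Num.max 0 (phi u - tau * B) + lam * (u == v0)%:R by [].
have lam0 : 0 <= lam by rewrite le_max lexx.
have tau0 : 0 <= tau by rewrite le_min ler01 mulr_ge0 // subr_ge0.
have tauB0 : 0 <= tau * B by exact: mulr_ge0.
have h0 u : 0 <= h u by rewrite hE addr_ge0 ?mulr_ge0 // le_max lexx.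
have hW u : u \notin W -> h u = 0 by exact: cone_coord_out.
pose S := [fset u in W | 0 < h u]%fset.
have SE u : (u \in S) = (0 < h u).
  by rewrite !inE /=; have [//|/hW ->] := boolP (u \in W); rewrite ltxx.
have SW : (S `<=` W)%fset by apply/fsubsetP => u; rewrite !inE => /andP[].
have [r2|r2] := ltP rho 2^-1.
  have tau1 : tau = 1 by rewrite /tau min_l //; lra.
  have lamE : lam = 1 - 2 * rho by rewrite /lam max_r //; lra.
  pose S0 := [fset u in W | B < phi u]%fset.
  have S0E : S = (v0 |` S0)%fset.
    apply/fsetP => u; rewrite SE hE tau1 mul1r lamE in_fset1U !inE /=.
    have [->|uv] := eqVneq u v0.
      by rewrite mulr1 ltr_wpDl ?le_max ?lexx //; lra.
    rewrite mulr0 addr0 lt_max ltxx /= subr_gt0.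
    by have [//|/phiW ->] := boolP (u \in W); rewrite ltNge B_ge0.
  have MS : M S.
    rewrite S0E; have [->|S00] := eqVneq S0 fset0; first by rewrite fsetU0.
    apply/M_cone/B_face => // [|u]; last by rewrite !inE => /andP[].
    by apply/fsubsetP => u; rewrite !inE => /andP[].
  have [N0 [y yE]] := realization_of (MK MS) SE h0 SW.
  split => //; exists y => //; apply: (thickening_support MS) => u.
  by rewrite SE yE pmulr_lgt0 // invr_gt0.
have r0 : 0 < rho by lra.
have [x [s Ms [t t0 st]] phix] : exists2 x : X, thickening M x & forall u, phi u = rho * x u.
  by case: Hx => // rE; move: r0; rewrite rE ltxx.
have Brt := B_lt r0 phix Ms t0 st.
have tauB : tau * B < rho * t.
  by apply: le_lt_trans Brt; rewrite ler_piMl // ge_min lexx.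
have lamE : lam = 0 by rewrite /lam max_l //; lra.
have {}hE u : h u = Num.max 0 (phi u - tau * B) by rewrite hE lamE mul0r addr0.
set thr := rho * t - tau * B.
have thr0 : 0 < thr by rewrite subr_gt0.
have sh v : if v \in s then thr < h v else h v < thr.
  rewrite hE phix; have := st v; case: ifP => _ xt.
    by rewrite lt_max ltrD2r ltr_pM2l // xt orbT.
  by rewrite gt_max thr0 ltrD2r ltr_pM2l.
have KS : simplexes K S.
  have [u Ku uE] := support_simplex x; apply: (simplex_face Ku).
    apply/fsubsetP => v; rewrite SE uE hE lt_max ltxx /= phix subr_gt0.
    by move=> /(le_lt_trans tauB0); rewrite pmulr_rgt0.
  have /fset0Pn[v vs] := simplex_neq0 (MK Ms).
  apply/fset0Pn; exists v; rewrite SE; apply: lt_trans thr0 _.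
  by have := sh v; rewrite vs.
have [N0 [y yE]] := realization_of KS SE h0 SW.
split => //; exists y => //; exists s => //; exists (thr / \sum_(w <- W) h w).
  exact: divr_gt0.
by move=> v; have := sh v; rewrite yE; case: ifP => _; rewrite ltr_pM2r ?invr_gt0.
Qed.

End Pointwise.

Lemma fillable_cone n : fillable R n (@thickening R V K M).
Proof.
have [x0 x0M] : @thickening R V K M !=set0.
  have [v|v||_ [x xE]] := @realization_of R V K [fset v0]%fset [fset v0]%fset
      (fun v => (v == v0)%:R) (MK M_apex).
  - by rewrite in_fset1 ltr0n lt0b.
  - exact: ler0n.
  - exact: fsubset_refl.
  exists x; apply: (thickening_support M_apex) => v.
  by rewrite xE big_seq_fset1 eqxx divr1 in_fset1 ltr0n lt0b.
split; first by exists x0.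
move=> f cf fM.
have [W0 fW0] := compact_finite_support (continuous_compact cf (@compact_cube_boundary R n)).
pose W := (v0 |` W0)%fset.
have fW y u : cube_boundary y -> u \notin W -> f y u = 0.
  move=> Sy uW; apply: (fW0 (f y)); first by exists y.
  by apply: contra uW => uW0; rewrite in_fset1U uW0 orbT.
have v0W : v0 \in W by rewrite in_fset1U eqxx.
pose phi (z : 'rV[R]_n) u := `|z| * f (`|z|^-1 *: z) u.
have bd (z : 'rV[R]_n) : z != 0 -> cube_boundary (`|z|^-1 *: z).
  by move=> z0; rewrite /cube_boundary /= normrZ normfV normr_id mulVf ?normr_eq0.
have cphi u : {within @cube R n, continuous (phi^~ u)}.
  apply: (@within_radial R n (fun y => f y u)) => [|y _].
    apply: (@within_compose _ _ _ _ setT f (fun x : X => x u) cf) => //.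
    exact/continuous_subspaceT/bary_continuous.
  by rewrite ger0_norm ?bary_ge0 ?bary_le1.
pose h (z : 'rV[R]_n) := cone_coord W `|z| (phi z).
pose N z := \sum_(w <- W) h z w.
have phiW z u : u \notin W -> phi z u = 0.
  move=> uW; rewrite /phi; have [->|z0] := eqVneq z 0; first by rewrite normr0 mul0r.
  by rewrite fW ?mulr0 //; exact: bd.
have pw z : cube z -> 0 < N z /\
    exists2 y : X, thickening M y & forall u, y u = h z u / N z.
  move=> cz; apply: cone_pointwise => //.
  - by move=> u; rewrite /phi ler_piMr ?bary_le1.
  - by move=> u; exact: phiW.
  - have [->|z0] := eqVneq z 0; first by left; rewrite normr0.
    by right; exists (f (`|z|^-1 *: z)) => //; exact/fM/bd.
have /choice[g gP] : forall z, exists y : X, cube z ->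
    thickening M y /\ forall u, y u = h z u / N z.
  move=> z; have [cz|ncz] := pselect (cube z); last by exists x0.
  by have [_ [y My yE]] := pw z cz; exists y.
have ch u : {within @cube R n, continuous (h^~ u)}.
  apply: withinD; last first.
    apply: withinM; last exact: within_cst.
    apply: within_max; first exact: within_cst.
    apply: withinB; first exact: within_cst.
    by apply: withinM; [exact: within_cst|exact: within_row_norm].
  apply: within_max; first exact: within_cst.
  apply: withinB => //; apply: withinM.
    apply: within_min; first exact: within_cst.
    apply: withinM; first exact: within_cst.
    by apply: withinB; [exact: within_cst|exact: within_row_norm].
  apply: within_bigmax => [|T]; first exact: within_cst.
  by apply: within_bigmin => //; exact: within_row_norm.
exists g; split.
- apply: (within_realization (W := W)).
    move=> z cz u uW; have [_ ->] := gP z cz.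
    by rewrite /h cone_coord_out ?mul0r // => w; exact: phiW.
  move=> u; apply: (eq_within (f := fun z => h z u / N z)).
    by move=> z /gP[_ ->].
  apply: withinM => //; apply: withinV => [z /pw[N0 _]|]; first by rewrite gt_eqF.
  exact: within_sum.
- by move=> z /gP[].
- move=> z Sz; have cz : cube z by rewrite /cube /= Sz.
  have hf u : h z u = f z u.
    rewrite /h /cone_coord /phi Sz subrr mulr0 invr1 scale1r mul1r.
    rewrite min_r // mul0r subr0 max_r ?bary_ge0 // max_l ?mul0r ?addr0 //; lra.
  apply: bary_inj => u; have [_ ->] := gP z cz.
  rewrite hf (_ : N z = 1) ?divr1 //.
  have [_ _ <-] := geometric_simplex_supp (fW z ^~ Sz).
  by apply: eq_bigr => w _.
Qed.

End Cone.

(** * Intersections of stars *)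

Lemma card_le_fsetP (T : choiceType) (A : set T) n :
  A #<= `I_n <-> exists2 F : {fset T}, A = [set` F] & (#|` F| <= n)%N.
Proof.
have card (F : {fset T}) : [set` F] #= `I_#|` F| by exact/card_eq_fsetP.
split=> [An|[F -> Fn]]; last by rewrite (card_le_eql (card F)) card_le_II.
have /finite_fsetP[F AF] := card_le_finite An (finite_II n).
by exists F => //; move: An; rewrite AF (card_le_eql (card F)) card_le_II.
Qed.

Section StarIntersections.
Context (V : choiceType) (L : simplicial_complex V).

Section Complex.
Context (s : seq V).

Let star_inter_set : set {fset V} :=
  [set t | simplexes L t /\ forall v, v \in s -> simplexes L (v |` t)%fset].

Lemma star_inter_neq0 t : star_inter_set t -> t != fset0.
Proof. by move=> [/simplex_neq0]. Qed.

Lemma star_inter_face (t u : {fset V}) :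
  star_inter_set t -> (u `<=` t)%fset -> u != fset0 -> star_inter_set u.
Proof.
move=> [Lt Lst] ut u0; split; first exact: (simplex_face Lt).
move=> v vs; apply: (simplex_face (Lst v vs)); first exact: fsetUS.
by apply/fset0Pn; exists v; exact: fset1U1.
Qed.

Definition star_inter : simplicial_complex V := Complex star_inter_neq0 star_inter_face.
End Complex.

Lemma simplexes_star_inter_cons v s : simplexes (star_inter (v :: s)) =
  simplexes (star_inter [:: v]) `&` simplexes (star_inter s).
Proof.
apply/seteqP; split => t /=.
  move=> [Lt Ls]; split; split => // w.
    by rewrite inE => /eqP ->; apply: Ls; exact: mem_head.
  by move=> ws; apply: Ls; rewrite inE ws orbT.
move=> [[Lt Lv] [_ Ls]]; split=> // w; rewrite inE => /orP[/eqP ->|/Ls//].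
by apply: Lv; exact: mem_head.
Qed.

(* [property_Q r] is [star_property r.+1]; the shift makes the property of the
   star intersections uniform. *)
Definition star_property (q : nat) (N : simplicial_complex V) :=
  forall M : simplicial_complex V, subcomplex M N ->
    vertices M #<= `I_(2 * q) -> simplexes M #<= `I_(3 ^ q - 1) ->
    exists2 v, vertices N v & subcomplex M (closed_star N v).

Section ConeOver.
Context (M : simplicial_complex V) (s : seq V).

Let cones : set {fset V} := [set t | simplexes M t \/
  exists2 v, v \in s & exists2 u, u = fset0 \/ simplexes M u & t = (v |` u)%fset].

Lemma cones_neq0 t : cones t -> t != fset0.
Proof.
move=> [/simplex_neq0//|[v _ [u _ ->]]].
by apply/fset0Pn; exists v; exact: fset1U1.
Qed.

Lemma cones_face (t t' : {fset V}) :
  cones t -> (t' `<=` t)%fset -> t' != fset0 -> cones t'.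
Proof.
move=> [Mt tt t0|[v vs [u Mu ->]] tu t0]; first by left; exact: (simplex_face Mt).
have Mu' (u' : {fset V}) : (u' `<=` u)%fset -> u' != fset0 -> simplexes M u'.
  move=> u'u u'0; case: Mu => [u0|Mu]; last exact: (simplex_face Mu).
  by move: u'u; rewrite u0 fsubset0 (negbTE u'0).
have tvu : (t' `\ v `<=` u)%fset by rewrite fsubDset.
have [vt|vt] := boolP (v \in t').
  right; exists v => //; exists (t' `\ v)%fset; last by rewrite fsetD1K.
  by have [->|] := eqVneq (t' `\ v)%fset fset0; [left|right; exact: Mu'].
by left; apply: Mu' => //; move: tvu; rewrite mem_fsetD1.
Qed.

Definition cones_complex : simplicial_complex V := Complex cones_neq0 cones_face.
End ConeOver.

Lemma star_property_star_inter p q s : uniq s -> (1 < size s)%N ->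
  (p + size s)%N = q.+1 -> (forall v, v \in s -> vertices L v) ->
  star_property q L -> star_property p (star_inter s).
Proof.
move=> us s2 pq Ls QL M ML /card_le_fsetP[VM VME VMn] /card_le_fsetP[FM FME FMn].
have [k [k2 pk sk]] : exists k, [/\ (1 < k)%N, (p + k)%N = q.+1 & size s = k].
  by exists (size s).
have card_seq (T : choiceType) (A : set T) (l : seq T) n :
    A `<=` [set` l] -> (size l <= n)%N -> A #<= `I_n.
  move=> Al ln; apply: card_le_trans (subset_card_le Al) _.
  apply/card_le_fsetP; exists [fset x in l]%fset.
    by apply/seteqP; split => x; rewrite /= inE.
  by apply: leq_trans ln; rewrite card_fseq size_undup.
have [|||w Lw Mw] := QL (cones_complex M s).
- move=> t [/ML[]//|[v vs [u Mu ->]]].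
  by case: Mu => [->|/ML[_]]; [rewrite fsetU0; exact: Ls|exact].
- apply: (card_seq _ _ (VM ++ s)).
    move=> v /= [Mv|[v' vs [u _ e]]]; rewrite mem_cat.
      by apply/orP; left; have : vertices M v by []; rewrite VME.
    apply/orP; right; suff -> : v = v' by [].
    by apply/esym/eqP; rewrite -in_fset1 e fset1U1.
  have {}VMn : (size VM <= 2 * p)%N := VMn.
  by rewrite size_cat [X in (_ + X)%N]sk; lia.
- apply: (card_seq _ _ (FM ++ [seq (v |` u)%fset | v <- s, u <- fset0 :: FM])).
    move=> t /= [Mt|[v vs [u Mu ->]]]; rewrite mem_cat; apply/orP.
      by left; have : simplexes M t by []; rewrite FME.
    right; apply/flatten_mapP; exists v => //; rewrite inE; case: Mu => [->|].
      by rewrite eqxx.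
    by rewrite FME /= => uF; rewrite (map_f (fun u => v |` u)%fset uF) orbT.
  rewrite size_cat size_allpairs [X in (_ + X * _)%N]sk /=.
  have qE : q = (p + k.-1)%N by lia.
  have : (3 ^ p * k.+1 <= 3 ^ q)%N.
    rewrite qE expnD leq_mul2l; apply/orP; right.
    case: k k2 {pk sk qE} => [|[|k]] // _ /=.
    by elim: k => // k IHk; rewrite expnS; lia.
  have arith (f a b : nat) : (0 < a)%N -> (f <= a - 1)%N -> (a * k.+1 <= b)%N ->
      (f + k * f.+1 <= b - 1)%N by nia.
  by apply: arith => //; rewrite expn_gt0.
have Mw0 v : v \in s -> simplexes L [fset w; v]%fset.
  move=> vs; have [|_] := Mw [fset v]%fset; last by [].
  by right; exists v => //; exists fset0; [left|rewrite fsetU0].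
exists w.
  by split => // v vs; rewrite fsetUC; exact: Mw0.
move=> u Mu; split; first exact: ML.
split; first by have [|_] := Mw u; [left|].
move=> v vs; have [|_] := Mw (v |` u)%fset.
  by right; exists v => //; exists u; [right|].
by rewrite fsetUCA.
Qed.

End StarIntersections.

(** * Connectivity *)

Section Filling.
Context (R : realType) (V : choiceType) (K : simplicial_complex V).
Local Notation X := (realization R K).
Local Notation thick L := (@thickening R V K (simplexes L)).

Lemma thickening_star_inter (L : simplicial_complex V) s : s != [::] ->
  \bigcap_(v in [set` s]) thick (star_inter L [:: v]) = thick (star_inter L s).
Proof.
elim: s => // v s IHs _; have [->|s0] := eqVneq s [::].
  by rewrite set_cons1 bigcap_set1.
rewrite set_consU1 bigcap_setU1 IHs // (simplexes_star_inter_cons L v s) thickeningI //.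
- exact: simplex_face.
- exact: simplex_face.
- exact: simplex_neq0.
- exact: simplex_neq0.
Qed.

Lemma fillable_star (L : simplicial_complex V) v n : subcomplex L K ->
  vertices L v -> fillable R n (thick (star_inter L [:: v])).
Proof.
move=> LK Lv; have mem1 w : w \in [:: v] -> w = v by rewrite inE => /eqP.
apply: (@fillable_cone R V K _ v).
- by move=> s [/LK].
- by move=> s t; exact: simplex_face.
- by split => // w /mem1 ->; rewrite fsetUid.
- move=> s [Ls Lvs]; have Lv' := Lvs v (mem_head _ _); split => // w /mem1 ->.
  by rewrite fsetUA fsetUid.
Qed.

Lemma fillable_star_property q (L : simplicial_complex V) : subcomplex L K ->
  star_property q L -> fillable_below R q.+1 (thick L).
Proof.
elim/ltn_ind: q L => q IHq L LK QL n nq.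
have [v0 Lv0] : exists v, vertices L v.
  pose M0 : simplicial_complex V :=
    @Complex V set0 (fun s (H : set0 s) => False_ind _ H)
      (fun s t (H : set0 s) _ _ => False_ind _ H).
  have [|||v Lv _] := QL M0; last by exists v.
  - by [].
  - exact: card_ge0.
  - exact: card_ge0.
have star_sub v : thick (star_inter L [:: v]) `<=` thick L.
  by apply: thickening_mono => s [].
have [[x0 x0L] _] := fillable_star n LK Lv0.
split; first by exists x0; exact: star_sub x0L.
move=> f cf fL.
have [W fW] := compact_finite_support
  (continuous_compact cf (@compact_cube_boundary R n)).
pose S := [fset v in v0 |` W | `[< vertices L v >]]%fset.
have SL v : v \in S -> vertices L v by rewrite !inE /= => /andP[_ /asboolP].
have v0S : v0 \in S by rewrite !inE /= eqxx; exact/asboolP.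
pose s : seq V := enum_fset S.
have s0 : s != [::] by apply: contraTneq v0S => s0; rewrite /S -[_ \in _]/(v0 \in s) s0.
have fS y : cube_boundary y ->
    (\bigcup_(v in [set` s]) thick (star_inter L [:: v])) (f y).
  move=> Sy; have [t Lt [e e0 tf]] := fL y Sy.
  have /fset0Pn[v vt] := simplex_neq0 Lt.
  have vW : v \in W.
    apply: contraT => vW; have := tf v; rewrite vt (fW (f y) _ _ vW).
      by rewrite ltNge (ltW e0).
    by exists y.
  have Lv : vertices L v.
    apply: (simplex_face Lt); first by rewrite fsub1set.
    by apply/fset0Pn; exists v; rewrite in_fset1.
  exists v; first by rewrite /= /s !inE /= vW orbT; exact/asboolP.
  exists t; last by exists e.
  split => // w; rewrite inE => /eqP ->.
  by rewrite fsetUC (fsetUidPl _ _ _) // fsub1set.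
have [_ /(_ f cf fS)[g [cg gS gf]]] : fillable R n
    (\bigcup_(v in [set` s]) thick (star_inter L [:: v])).
  apply: (@fillable_below_bigcup R X q.+1) nq => //.
    by move=> v; exact: open_thickening.
  move=> t ts t0 m mt; rewrite thickening_star_inter //.
  have tL v : v \in t -> vertices L v by move=> /(mem_subseq ts) /SL.
  have ut : uniq t := subseq_uniq ts (fset_uniq S).
  case: t t0 {ts} mt tL ut => // v [|w t] _ mt tL ut.
    by apply: fillable_star => //; exact/tL/mem_head.
  have [k kE] : exists k, size [:: v, w & t] = k.+2 by exists (size t).
  rewrite [X in (_ - X)%N]kE in mt.
  apply: (IHq (q.+1 - k.+2)%N); first lia.
  - by move=> u [/LK].
  - by apply: (star_property_star_inter ut _ _ tL QL); rewrite ?[size _]kE; lia.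
  - lia.
exists g; split => // z /gS[v _]; exact: star_sub.
Qed.

End Filling.

Section Euclidean.
Context (R : realType) (X : topologicalType) (d : nat).
Implicit Types x : 'rV[R]_d.+1.

Let nrm x : R := Num.sqrt (\sum_i x ord0 i ^+ 2).

Let nrm_ge0 x : 0 <= nrm x. Proof. exact: sqrtr_ge0. Qed.

Let nrm_eq0 x : (nrm x == 0) = (x == 0).
Proof.
have s0 : 0 <= \sum_i x ord0 i ^+ 2 by apply: sumr_ge0 => i _; exact: sqr_ge0.
rewrite /nrm sqrtr_eq0 le_eqVlt ltNge s0 orbF.
apply/eqP/eqP => [|->]; last by rewrite big1 // => i _; rewrite mxE expr0n.
move=> /psumr_eq0P H; apply/rowP => i; rewrite mxE; apply/eqP.
by rewrite -sqrf_eq0 H // => j _; exact: sqr_ge0.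
Qed.

Let nrmZ a x : 0 <= a -> nrm (a *: x) = a * nrm x.
Proof.
move=> a0; rewrite /nrm (eq_bigr (fun i => a ^+ 2 * x ord0 i ^+ 2)).
  by rewrite -mulr_sumr sqrtrM ?sqr_ge0 // sqrtr_sqr ger0_norm.
by move=> i _; rewrite mxE exprMn.
Qed.

Let unit_sphereE x : unit_sphere R d x <-> nrm x = 1.
Proof.
rewrite /unit_sphere /nrm /=; split => [->|n1]; first exact: sqrtr1.
by rewrite -[LHS]sqr_sqrtr ?n1 ?expr1n //; apply: sumr_ge0 => i _; exact: sqr_ge0.
Qed.

Let normalize x := (nrm x)^-1 *: x.

Let normalize_sphere x : x != 0 -> unit_sphere R d (normalize x).
Proof.
move=> x0; apply/unit_sphereE; rewrite nrmZ ?invr_ge0 //.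
by rewrite mulVf // nrm_eq0.
Qed.

Let normalizeZ a x : 0 < a -> normalize (a *: x) = normalize x.
Proof.
move=> a0; rewrite /normalize nrmZ ?ltW // scalerA invfM mulrAC mulVf ?mul1r //.
by rewrite gt_eqF.
Qed.

Let within_normalize D : (forall x, D x -> x != 0) -> {within D, continuous normalize}.
Proof.
move=> D0; apply: within_row => i.
rewrite (_ : (fun _ => _) = (fun x => (nrm x)^-1 * x ord0 i)); last first.
  by apply/funext => x; rewrite mxE.
apply: withinM; last exact: within_coord_id.
apply: withinV => [x /D0|]; first by rewrite nrm_eq0.
apply: (@within_compose _ _ _ _ setT (fun x => \sum_i x ord0 i ^+ 2) Num.sqrt) => //.
  by apply: within_sum => j; apply: withinM; exact: within_coord_id.
exact/continuous_subspaceT/sqrt_continuous.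
Qed.

Lemma fillable_sphere (f : 'rV[R]_d.+1 -> X) : fillable R d.+1 [set: X] ->
  {within unit_sphere R d, continuous f} ->
  exists2 g : 'rV[R]_d.+1 -> X,
    {within unit_disk R d.+1, continuous g} &
    forall x, unit_sphere R d x -> g x = f x.
Proof.
move=> [_ fill] cf.
have cfn D : (forall x, D x -> x != 0) -> {within D, continuous (f \o normalize)}.
  move=> D0; apply: (@within_compose _ _ _ _ _ normalize f (within_normalize D0) cf).
  by move=> x /D0; exact: normalize_sphere.
have [||G [cG _ Gf]] := fill (f \o normalize).
- by apply: cfn => x x1; rewrite -normr_eq0 x1; exact: oner_neq0.
- by [].
pose c : R := d.+1%:R^-1.
have c0 : 0 < c by rewrite invr_gt0 ltr0n.
have small x : unit_sphere R d x -> c <= `|x|.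
  move=> Sx; rewrite leNgt; apply/negP => xc.
  have : \sum_i x ord0 i ^+ 2 <= \sum_(i < d.+1) `|x|.
    apply: ler_sum => i _; have xi := le_coord_norm x i.
    have x1 : `|x| <= 1 by rewrite (le_trans (ltW xc)) // invf_le1 ?ltr0n // ler1n.
    rewrite -[x ord0 i ^+ 2]ger0_norm ?sqr_ge0 // normrX expr2.
    by rewrite (le_trans _ xi) // ler_piMr // (le_trans xi).
  rewrite Sx sumr_const card_ord -mulr_natr leNgt => /negP; apply.
  by rewrite -ltr_pdivlMr ?ltr0n // mul1r.
pose g x := if `|x| <= c then G (c^-1 *: x) else f (normalize x).
pose D1 : set 'rV[R]_d.+1 := [set x | `|x| <= c].
pose D2 : set 'rV[R]_d.+1 := [set x | c <= `|x|].
have g2 x : D2 x -> g x = f (normalize x).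
  rewrite /D2 /g /= => cx; case: ifP => // xc.
  have xE : `|x| = c by apply/le_anti; rewrite xc.
  rewrite Gf /= ?normalizeZ ?invr_gt0 //.
  by rewrite /cube_boundary /= normrZ xE ger0_norm ?invr_ge0 ?ltW // mulVf ?gt_eqF.
exists g; last first.
  move=> x Sx; rewrite g2; last exact: small.
  by have /unit_sphereE n1 := Sx; rewrite /normalize n1 invr1 scale1r.
apply: (@continuous_subspaceW _ _ _ (D1 `|` D2)).
  by move=> x _; have [|/ltW] := leP `|x| c; [left|right].
apply: withinU_continuous.
- have -> : D1 = Num.norm @^-1` [set r | r <= c] by [].
  by apply: preimage_closed => [x _|]; [exact: norm_continuous|exact: closed_le].
- have -> : D2 = Num.norm @^-1` [set r | c <= r] by [].
  by apply: preimage_closed => [x _|]; [exact: norm_continuous|exact: closed_ge].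
- apply: (eq_within (f := G \o (fun x => c^-1 *: x))).
    by move=> x; rewrite /D1 /g /= => ->.
  apply: (@within_compose _ _ _ _ _ (fun x => c^-1 *: x) G _ cG).
    apply: within_row => i.
    rewrite (_ : (fun _ => _) = (fun x : 'rV[R]_d.+1 => c^-1 * x ord0 i)); last first.
      by apply/funext => x; rewrite mxE.
    by apply: withinM; [exact: within_cst|exact: within_coord_id].
  move=> x xc; rewrite /cube /= normrZ ger0_norm ?invr_ge0 ?(ltW c0) //.
  by rewrite mulrC ler_pdivrMr // mul1r.
- apply: (eq_within (f := f \o normalize)) => [x /g2 ->//|].
  by apply: cfn => x cx; rewrite -normr_gt0; exact: lt_le_trans cx.
Qed.

End Euclidean.

Theorem theorem8 (R : realType) (V : choiceType) (K : simplicial_complex V) (r : nat) :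
  property_Q r K -> complex_r_connected R r K.
Proof.
move=> QK.
have fill n : (n < r.+2)%N -> fillable R n [set: realization R K].
  rewrite -thickening_complex; apply: fillable_star_property => // M MK Mv Ms.
  by apply: QK => //; rewrite addnC -mulnS.
split; first by have [] := fill 0%N isT.
by move=> d dr f; apply: fillable_sphere; exact: fill.
Qed.
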